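(* Let $\mathcal T=(T(t))_{t\ge0}$ be a $C_0$-semigroup on a Hilbert space $(H,\|\cdot\|)$ with generator $E$. Then $\mathcal T$ is similar to a semigroup of contractions (i.e. $\|RT(t)R^{-1}\|\le1$ for all $t\ge0$ for some invertible $R\in\mathcal L(H)$) if and only if there exist a Hilbert space $(K,\|\cdot\|_K)$ and a densely defined linear operator $C:\operatorname{dom}(C)\subseteq H\to K$ such that: (i) $T(t)(\operatorname{dom}(C))\subseteq\operatorname{dom}(C)$ for all $t\ge0$; (ii) for every $h\in\operatorname{dom}(C)$ the map $[0,\infty)\ni t\mapsto CT(t)h\in K$ is Bochner measurable; (iii) there exist $\alpha,\beta>0$ with $$\alpha\|h\|^2\le\|T(t)h\|^2+\int_0^t\|CT(s)h\|_K^2\,ds\le\beta\|h\|^2,\qquad h\in\operatorname{dom}(C),\ t\ge0.$$ Moreover, when such $K$ and $C$ exist, $C$ can be chosen with $\operatorname{dom}(C)=\operatorname{dom}(E)$ and bounded from $\operatorname{dom}(E)$, equipped with the graph norm, to $K$.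
   Context: The graph norm on $\operatorname{dom}(E)$ is $\|h\|_{\operatorname{dom}(E)}=(\|h\|^2+\|Eh\|^2)^{1/2}$. *)

(* Defs.v *)
From HB Require Import structures.
From mathcomp Require Import all_boot all_order all_algebra.
From mathcomp Require Import all_classical all_reals all_analysis.
From mathcomp Require Import complex.
Set Implicit Arguments. Unset Strict Implicit. Unset Printing Implicit Defensive.
Import Order.TTheory GRing.Theory Num.Theory.
Import numFieldNormedType.Exports.
Local Open Scope ring_scope.
Local Open Scope classical_set_scope.

Section Defs.
Variable R : realType.

Definition rC (t : R) : R[i] := (t%:C)%C.

Definition nrm (V : normedModType R[i]) (x : V) : R := complex.Re `|x|.

Definition is_inner_product (V : normedModType R[i]) (ip : V -> V -> R[i]) :=
  [/\ forall (a : R[i]) (x y z : V), ip (a *: x + y) z = a * ip x z + ip y z,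
      forall x y : V, ip x y = (ip y x)^*
    & forall x : V, ip x x = `|x| ^+ 2].

Definition hilbert_norm (V : completeNormedModType R[i]) :=
  exists ip : V -> V -> R[i], is_inner_product ip.

Definition bounded_op (V W : normedModType R[i]) (L : V -> W) :=
  (forall (a : R[i]) (x y : V), L (a *: x + y) = a *: L x + L y) /\ continuous L.

(* C_0-semigroup (T t only matters for t >= 0) *)
Definition C0_semigroup (V : normedModType R[i]) (T : R -> V -> V) :=
  [/\ forall t, 0 <= t -> bounded_op (T t),
      forall x, T 0 x = x,
      forall s t, 0 <= s -> 0 <= t -> forall x, T (s + t) x = T s (T t x)
    & forall x, {within `[0, +oo[, continuous (fun t => T t x)}].

Definition diffq (V : normedModType R[i]) (T : R -> V -> V) (x : V) (t : R) : V :=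
  rC t^-1 *: (T t x - x).

Definition gen_dom (V : normedModType R[i]) (T : R -> V -> V) : set V :=
  [set x | exists y : V, diffq T x t @[t --> 0^'+] --> y].

(* the generator E of T (on its domain) *)
Definition gen (V : normedModType R[i]) (T : R -> V -> V) (x : V) : V :=
  lim (diffq T x t @[t --> 0^'+]).

Definition graph_norm (V : normedModType R[i]) (T : R -> V -> V) (h : V) : R :=
  Num.sqrt (nrm h ^+ 2 + nrm (gen T h) ^+ 2).

Definition similar_to_contraction (V : normedModType R[i]) (T : R -> V -> V) :=
  exists Rop Rinv : V -> V,
    [/\ bounded_op Rop, bounded_op Rinv, cancel Rop Rinv, cancel Rinv Rop
      & forall t, 0 <= t -> forall x, nrm (Rop (T t (Rinv x))) <= nrm x].

Definition subspace (V : normedModType R[i]) (D : set V) :=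
  D 0 /\ forall (a : R[i]) x y, D x -> D y -> D (a *: x + y).

Definition linear_on (V W : normedModType R[i]) (D : set V) (C : V -> W) :=
  forall (a : R[i]) x y, D x -> D y -> C (a *: x + y) = a *: C x + C y.

Definition simple_on (W : normedModType R[i]) (D : set R) (g : R -> W) :=
  finite_set (g @` D) /\ forall y : W, measurable (D `&` g @^-1` [set y]).

Definition bochner_measurable (W : normedModType R[i]) (D : set R) (f : R -> W) :=
  exists g : nat -> R -> W, (forall n, simple_on D (g n)) /\
    {ae (@lebesgue_measure R), forall t, D t -> g n t @[n --> \oo] --> f t}.

Definition admissible (V W : normedModType R[i]) (T : R -> V -> V)
    (D : set V) (C : V -> W) :=
  [/\ [/\ subspace D, dense D & linear_on D C],
      (* (i) *) forall t, 0 <= t -> forall h, D h -> D (T t h),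
      (* (ii) *) forall h, D h -> bochner_measurable `[0, +oo[ (fun t => C (T t h))
    & (* (iii) *) exists alpha beta : R, [/\ 0 < alpha, 0 < beta &
        forall h t, D h -> 0 <= t ->
          ((alpha * nrm h ^+ 2)%:E <=
             (nrm (T t h) ^+ 2)%:E
             + \int[@lebesgue_measure R]_(s in `[0%R, t]%classic) ((nrm (C (T s h)) ^+ 2)%:E)
           <= (beta * nrm h ^+ 2)%:E)%E]].

End Defs.

(* Main.v *)
Require Import Defs.
From HB Require Import structures.
From mathcomp Require Import all_boot all_order all_algebra.
From mathcomp Require Import all_classical all_reals all_analysis measurable_realfun.
From mathcomp Require Import complex.
From mathcomp Require Import ring lra.
Import Order.TTheory GRing.Theory Num.Theory.
Import numFieldNormedType.Exports.
Local Open Scope ring_scope.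
Local Open Scope classical_set_scope.

Set Implicit Arguments.
Unset Strict Implicit.
Unset Printing Implicit Defensive.

(** Proof idea.

    From admissibility to contractions: for [h] in the domain of [C], the energies
    [b_t(h, h) = |T(t)h|^2 + int_0^t |C T(s)h|^2 ds] are hermitian forms lying between [al |h|^2] and
    [be |h|^2], and [b_t(T(s)h, T(s)h) <= b_(t+s)(h, h)].  A translation invariant mean over [t] produces
    a form [b] equivalent to the norm with [b(T(s)h, T(s)h) <= b(h, h)].  The Riesz theorem and an
    operator square root give an invertible [S] with [|S h|^2 = b(h, h)], and [S T(t) S^-1] is contractive.

    From contractions to admissibility: if [|S T(t) h| <= |S h|] and [E] generates [T], then
    [p(h) = - 2 Re <S E h, S h>] is non-negative on [dom E].  As [1 - E] maps [dom E] bijectively onto [H],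
    [p((1 - E)^-1 x)] is a bounded form on [H], hence equals [|Z x|^2] for some operator [Z].  The choice
    [K = H], [C = Z (1 - E)] makes [|C T(t) h|^2] the rate of decay of [|S T(t) h|^2], so that
    [int_0^t |C T(s) h|^2 ds = |S h|^2 - |S T(t) h|^2]. *)

(** * Real-valued norms and completeness *)

(** The energies $b_t$ need not be monotone in $t$, and the shift inequality compares $b_t$ with
    $b_{t+s}$; only an average over $t$ that ignores shifts turns its two sides into values of one
    form.

    In the converse direction $p$ need not be bounded on $H$. Composed with $(1-E)^{-1}$ it becomes
    $\frac12(\|Sx\|^2-\|SPx\|^2)$ with the Cayley transform $P=(1+E)(1-E)^{-1}$, which is at most
    $\frac12\|Sx\|^2$. This form may degenerate, so the square root must be built without a positive
    lower bound.

    Two obstacles shape the first direction. The form $b$ lives only on the dense subspace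
    $\operatorname{dom}(C)$, so it has to be represented by an operator on all of $H$. And $s\mapsto
    CT(s)h$ is controlled only up to null sets, so the additivity of the energies passes through
    Borel representatives of the integrands. *)

Section Norm.
Variable R : realType.
Implicit Types V W : normedModType R[i].

Lemma rCD (a b : R) : rC (a + b) = rC a + rC b.
Proof. exact: rmorphD. Qed.

Lemma rCM (a b : R) : rC (a * b) = rC a * rC b.
Proof. exact: rmorphM. Qed.

Lemma rCV (a : R) : rC a^-1 = (rC a)^-1.
Proof. exact: fmorphV. Qed.

Lemma normrC (a : R) : `|rC a| = rC `|a|.
Proof. by rewrite normc_def /= expr0n /= addr0 sqrtr_sqr. Qed.

Lemma conj_rC (a : R) : (rC a)^* = rC a.
Proof. by rewrite /rC; exact: conjc_real. Qed.

Lemma normE V (x : V) : `|x| = rC (nrm x).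
Proof. by rewrite /rC /nrm RRe_real // ger0_real. Qed.

Lemma ler_rC (a b : R) : (rC a <= rC b) = (a <= b).
Proof. by rewrite /rC lecR. Qed.

Lemma ltr_rC (a b : R) : (rC a < rC b) = (a < b).
Proof. by rewrite /rC ltcR. Qed.

Lemma nrm_ge0 V (x : V) : 0 <= nrm x.
Proof. by rewrite -ler_rC -normE normr_ge0. Qed.

Lemma nrm0 V : nrm (0 : V) = 0.
Proof. by rewrite /nrm normr0. Qed.

Lemma nrm_eq0 V (x : V) : nrm x = 0 -> x = 0.
Proof. by move=> x0; apply/normr0_eq0; rewrite normE x0. Qed.

Lemma nrmN V (x : V) : nrm (- x) = nrm x.
Proof. by rewrite /nrm normrN. Qed.

Lemma nrmB V (x y : V) : nrm (x - y) = nrm (y - x).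
Proof. by rewrite -nrmN opprB. Qed.

Lemma ler_nrmD V (x y : V) : nrm (x + y) <= nrm x + nrm y.
Proof. by rewrite -ler_rC rCD -!normE ler_normD. Qed.

Lemma ler_nrmB V (x y : V) : nrm (x - y) <= nrm x + nrm y.
Proof. by rewrite -(nrmN y) ler_nrmD. Qed.

Lemma ler_dist_nrm V (x y : V) : `|nrm x - nrm y| <= nrm (x - y).
Proof.
rewrite ler_norml; apply/andP; split.
  by have := ler_nrmD x (y - x); rewrite addrCA subrr addr0 nrmB; lra.
by have := ler_nrmD y (x - y); rewrite addrCA subrr addr0; lra.
Qed.

Lemma nrmZ V (a : R) (x : V) : nrm (rC a *: x) = `|a| * nrm x.
Proof. by rewrite {1}/nrm normrZ normrC normE -rCM. Qed.

Lemma nrmZc V (a : R[i]) (x : V) : nrm (a *: x) = complex.Re `|a| * nrm x.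
Proof.
have -> : `|a| = rC (complex.Re `|a|) by rewrite /rC RRe_real // ger0_real.
by rewrite {1}/nrm normrZ [in LHS]normE -[`|a|]RRe_real ?ger0_real // -rCM.
Qed.

Lemma cvg_nrmP V (T : Type) (F : set_system T) {FF : Filter F} (f : T -> V) (l : V) :
  f @ F --> l <-> nrm (f x - l) @[x --> F] --> (0 : R).
Proof.
split.
  move=> /cvgrPdist_lt fl; apply/cvgrPdist_lt => e e0.
  have e0' : 0 < rC e by rewrite (_ : 0 = rC 0) // ltr_rC.
  apply: filterS (fl _ e0') => x.
  by rewrite sub0r normrN ger0_norm ?nrm_ge0 // nrmB normE ltr_rC.
move=> /cvgrPdist_lt fl; apply/cvgrPdist_lt => e e0.
(* A positive element of [R[i]] is real, so the complex radii of the topology are real radii. *)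
have eE : e = rC (complex.Re e) by rewrite /rC RRe_real // gtr0_real.
have e0' : 0 < complex.Re e by rewrite -ltr_rC -eE.
apply: filterS (fl _ e0') => x.
by rewrite sub0r normrN ger0_norm ?nrm_ge0 // nrmB eE normE ltr_rC.
Qed.

Lemma cvg_nrm V (T : Type) (F : set_system T) {FF : Filter F} (f : T -> V) (l : V) :
  f @ F --> l -> nrm (f x) @[x --> F] --> nrm l.
Proof.
move=> /cvg_nrmP fl; apply/cvgrPdist_le => e e0.
move/cvgrPdist_le : fl => /(_ _ e0); apply: filterS => x.
rewrite sub0r normrN ger0_norm ?nrm_ge0 // => h.
by apply: le_trans (ler_dist_nrm _ _) _; rewrite nrmB.
Qed.

Lemma squeeze0 (T : Type) (F : set_system T) {FF : Filter F} (f g : T -> R) :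
  (\forall x \near F, 0 <= f x <= g x) -> g @ F --> (0 : R) -> f @ F --> (0 : R).
Proof. by move=> fg g0; apply: (squeeze_cvgr fg) => //; exact: cvg_cst. Qed.

Lemma bounded_op_nrm V W (L : V -> W) :
  bounded_op L <-> (forall (a : R[i]) (x y : V), L (a *: x + y) = a *: L x + L y) /\
    exists2 M : R, 0 <= M & forall x, nrm (L x) <= M * nrm x.
Proof.
split=> -[linL]; last first.
  case=> M M0 LM; split => // x; apply/cvg_nrmP.
  have h : nrm (y - x) @[y --> x] --> (0 : R) by apply/cvg_nrmP; exact: cvg_id.
  have h2 : M * nrm (y - x) @[y --> x] --> (0 : R).
    by rewrite -(mulr0 M); apply: cvgMr.
  apply: squeeze0 h2; near=> y; rewrite nrm_ge0 /=.
  have -> : L y - L x = L (y - x); last exact: LM.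
  by rewrite addrC -scaleN1r -linL scaleN1r addrC.
move=> cL; split => //.
have L0 : L 0 = 0.
  have := linL 1 0 0; rewrite !scale1r addr0 => /eqP.
  by rewrite -subr_eq0 opprD addNKr oppr_eq0 => /eqP.
have LZ a x : L (a *: x) = a *: L x by rewrite -[a *: x]addr0 linL L0 addr0.
have /cvg_nrmP/cvgrPdist_lt/(_ _ ltr01) := cL 0.
rewrite L0 => /nbhs_ballP[d d0] dL.
pose e := complex.Re d.
have dE : d = rC e by rewrite /rC RRe_real // gtr0_real.
have e0 : 0 < e by rewrite -ltr_rC -dE.
exists (2 / e); first by rewrite divr_ge0 ?ltW.
move=> x; have [->|x0] := eqVneq x 0; first by rewrite L0 !nrm0 mulr0.
have nx0 : 0 < nrm x.
  by rewrite lt_def nrm_ge0 andbT; apply: contra_neq x0; exact: nrm_eq0.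
(* Scales [x] to norm [e / 2], inside the ball where [L] has norm below 1. *)
pose c := e / (2 * nrm x).
have c0 : 0 < c by rewrite divr_gt0 ?mulr_gt0.
have /dL /= : ball 0 d (rC c *: x).
  rewrite -ball_normE /= sub0r normrN normE dE ltr_rC nrmZ (gtr0_norm c0).
  rewrite /c; have -> : e / (2 * nrm x) * nrm x = e / 2 by field; rewrite gt_eqF.
  by rewrite ltr_pdivrMr // ltr_pMr // ltr1n.
rewrite subr0 sub0r normrN LZ nrmZ ger0_norm ?mulr_ge0 ?nrm_ge0 // (gtr0_norm c0) => h.
rewrite ltW //; rewrite -(ltr_pM2l c0); apply: (lt_le_trans h).
by rewrite le_eqVlt; apply/orP; left; apply/eqP; rewrite /c; field; rewrite !gt_eqF.
Unshelve. all: end_near.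
Qed.

End Norm.

Section Completeness.
Variable R : realType.
Variable V : completeNormedModType R[i].

Lemma cvg_of_cauchy (u : nat -> V) :
  (forall e : R, 0 < e -> exists N, forall m n, (N <= m)%N -> (N <= n)%N ->
    nrm (u m - u n) < e) -> exists l : V, u n @[n --> \oo] --> l.
Proof.
move=> hu; suff /cauchy_cvgP/cvg_ex[l ul] : cauchy (u n @[n --> \oo]) by exists l.
apply/cauchyP => e e0.
have eE : e = rC (complex.Re e) by rewrite /rC RRe_real // gtr0_real.
have e0' : 0 < complex.Re e by rewrite -ltr_rC -eE.
have [N hN] := hu _ e0'; exists (u N); exists N => // n Nn.
by rewrite /= -ball_normE /= eE normE ltr_rC; exact: hN.
Qed.

(** The scalar sequence [a] is nondecreasing and bounded, hence Cauchy, and the increments of [u]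
    inherit this. Both the Neumann iteration and the square root iteration converge by it. *)
Lemma cvg_majorized (u : nat -> V) (a : nat -> R) (M : R) :
  (forall n, nrm (u n.+1 - u n) <= a n.+1 - a n) -> (forall n, a n <= M) ->
  exists l : V, u n @[n --> \oo] --> l.
Proof.
move=> ua aM; apply: cvg_of_cauchy => e e0.
have a_nd : nondecreasing_seq a.
  by apply/nondecreasing_seqP => n; rewrite -subr_ge0 (le_trans _ (ua n)) ?nrm_ge0.
have uk m k : nrm (u (m + k)%N - u m) <= a (m + k)%N - a m.
  elim: k => [|k IH]; first by rewrite addn0 !subrr nrm0.
  rewrite addnS -(subrKA (u (m + k)%N)) (le_trans (ler_nrmD _ _)) //.
  by have := ua (m + k)%N; lra.
have hsup : has_sup (range a) by split; [exists (a 0%N), 0%N | exists M => _ [n _ <-]].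
have [_ [N _ <-] aN] := sup_adherent (divr_gt0 e0 (ltr0n _ 2)) hsup.
have aS n : a n <= sup (range a) by apply: ub_le_sup; [exact: hsup.2 | exists n].
exists N => m n Nm Nn.
have := uk N (m - N)%N; have := uk N (n - N)%N; rewrite !subnKC // => h1 h2.
rewrite -(subrKA (u N)) (le_lt_trans (ler_nrmD _ _)) // [nrm (u N - _)]nrmB.
by have := aS m; have := aS n; lra.
Qed.

End Completeness.

(** * Hermitian forms and the Riesz theorem *)

Lemma cvg_distP0 (R : realType) (T : Type) (F : set_system T) {FF : Filter F}
    (f : T -> R) (l : R) :
  f @ F --> l <-> `|f x - l| @[x --> F] --> (0 : R).
Proof.
split=> [fl|/cvgrPdist_lt fl].
  by rewrite -(@normr0 _ R) -(subrr l); apply: cvg_norm; apply: cvgB => //; exact: cvg_cst.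
apply/cvgrPdist_lt => e /fl; apply: filterS => x.
by rewrite sub0r normrN normr_id distrC.
Qed.

Section Forms.
Variables (R : realType) (V : normedModType R[i]).
Implicit Types (D : set V) (b : V -> V -> R).

(* A hermitian form is encoded by its real part [b]; sesquilinearity becomes the third clause. *)
Definition hform D b :=
  [/\ forall x y z, D x -> D y -> D z -> b (x + y) z = b x z + b y z,
      forall x y, D x -> D y -> b x y = b y x,
      forall (a : R[i]) x y, D x -> D y -> b (a *: x) y = b x (a^* *: y)
    & forall (a : R) x y, D x -> D y -> b (rC a *: x) y = a * b x y].

(** The real part of the inner product of the space. *)
Definition is_rip b := hform setT b /\ forall x, b x x = nrm x ^+ 2.

Section Subspace.
Variables (D : set V) (sD : Defs.subspace D).

Lemma sub0 : D 0. Proof. by case: sD. Qed.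

Lemma subZ a x : D x -> D (a *: x).
Proof. by move=> Dx; rewrite -[_ *: _]addr0; apply: sD.2 => //; exact: sub0. Qed.

Lemma subD x y : D x -> D y -> D (x + y).
Proof. by move=> Dx Dy; rewrite -[x]scale1r; apply: sD.2. Qed.

Lemma subN x : D x -> D (- x).
Proof. by rewrite -scaleN1r; exact: subZ. Qed.

Lemma subB x y : D x -> D y -> D (x - y).
Proof. by move=> Dx Dy; apply: subD => //; exact: subN. Qed.

End Subspace.

Lemma subspaceT : Defs.subspace [set: V]. Proof. by []. Qed.

Section FormTheory.
Variables (D : set V) (b : V -> V -> R) (sD : Defs.subspace D) (hb : hform D b).

Lemma hformDl x y z : D x -> D y -> D z -> b (x + y) z = b x z + b y z.
Proof. by case: hb => h _ _ _; exact: h. Qed.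

Lemma hformC x y : D x -> D y -> b x y = b y x.
Proof. by case: hb => _ h _ _; exact: h. Qed.

Lemma hformJ a x y : D x -> D y -> b (a *: x) y = b x (a^* *: y).
Proof. by case: hb => _ _ h _; exact: h. Qed.

Lemma hformZl a x y : D x -> D y -> b (rC a *: x) y = a * b x y.
Proof. by case: hb => _ _ _; exact. Qed.

Lemma hformZr a x y : D x -> D y -> b x (rC a *: y) = a * b x y.
Proof. by move=> Dx Dy; rewrite hformC ?hformZl 1?hformC //; exact: subZ. Qed.

Lemma hformDr x y z : D x -> D y -> D z -> b x (y + z) = b x y + b x z.
Proof.
move=> Dx Dy Dz; rewrite hformC ?hformDl //; last exact: subD.
by congr (_ + _); exact: hformC.
Qed.

Lemma hformNl x y : D x -> D y -> b (- x) y = - b x y.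
Proof.
move=> Dx Dy; have -> : - x = rC (-1) *: x by rewrite /rC rmorphN rmorph1 scaleN1r.
by rewrite hformZl // mulN1r.
Qed.

Lemma hformNr x y : D x -> D y -> b x (- y) = - b x y.
Proof. by move=> Dx Dy; rewrite hformC ?hformNl 1?hformC //; exact: subN. Qed.

Lemma hformBl x y z : D x -> D y -> D z -> b (x - y) z = b x z - b y z.
Proof. by move=> Dx Dy Dz; rewrite hformDl ?hformNl //; exact: subN. Qed.

Lemma hformBr x y z : D x -> D y -> D z -> b x (y - z) = b x y - b x z.
Proof. by move=> Dx Dy Dz; rewrite hformDr ?hformNr //; exact: subN. Qed.

Lemma hform_sqrD x y : D x -> D y ->
  b (x + y) (x + y) = b x x + 2 * b x y + b y y.
Proof.
move=> Dx Dy; rewrite hformDl ?hformDr //; last exact: subD.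
by rewrite (hformC Dy Dx); ring.
Qed.

Lemma hform_sqrB x y : D x -> D y ->
  b (x - y) (x - y) = b x x - 2 * b x y + b y y.
Proof.
move=> Dx Dy; have DN := subN sD Dy.
by rewrite hform_sqrD // hformNr // hformNl // hformNr //; ring.
Qed.

Lemma quadratic_discr (p q r : R) : 0 <= r ->
  (forall t, 0 <= p + 2 * t * q + t ^+ 2 * r) -> q ^+ 2 <= p * r.
Proof.
rewrite le_eqVlt => /predU1P[<-|r0] h.
  have [->|q0] := eqVneq q 0; first by rewrite expr0n /= mulr0.
  (* With [r = 0] the expression is affine in [t], and at this [t] it equals -1. *)
  have := h (- (p + 1) / (2 * q)).
  have -> : 2 * (- (p + 1) / (2 * q)) * q = - (p + 1) by field.
  by rewrite mulr0; move=> {q0}; lra.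
(* The minimiser of the quadratic. *)
have := h (- q / r).
have -> : p + 2 * (- q / r) * q + (- q / r) ^+ 2 * r = (p * r - q ^+ 2) / r.
  by field; rewrite gt_eqF.
by rewrite pmulr_lge0 ?invr_gt0 // subr_ge0.
Qed.

Lemma hform_CS x y : (forall z, D z -> 0 <= b z z) -> D x -> D y ->
  b x y ^+ 2 <= b x x * b y y.
Proof.
move=> b0 Dx Dy; apply: quadratic_discr => [|t]; first exact: b0.
have DZ := subZ sD (rC t) Dy.
suff <- : b (x + rC t *: y) (x + rC t *: y) =
    b x x + 2 * t * b x y + t ^+ 2 * b y y by apply: b0; exact: subD.
by rewrite hform_sqrD // hformZr // hformZl // hformZr //; ring.
Qed.

Lemma hform_bound x y c : 0 <= c ->
  (forall z, D z -> 0 <= b z z <= c * nrm z ^+ 2) -> D x -> D y ->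
  `|b x y| <= c * nrm x * nrm y.
Proof.
move=> c0 hc Dx Dy.
have b0 z : D z -> 0 <= b z z by case/hc/andP.
rewrite -(@ler_pXn2r _ 2) ?nnegrE ?mulr_ge0 ?nrm_ge0 // real_normK ?num_real //.
rewrite (le_trans (hform_CS b0 Dx Dy)) //.
have -> : (c * nrm x * nrm y) ^+ 2 = (c * nrm x ^+ 2) * (c * nrm y ^+ 2) by ring.
by case/andP: (hc _ Dx) => ? ?; case/andP: (hc _ Dy) => ? ?; exact: ler_pM.
Qed.

End FormTheory.

Lemma ripE r : is_rip r -> forall x, r x x = nrm x ^+ 2.
Proof. by case. Qed.

Lemma rip_hform r D : is_rip r -> hform D r.
Proof. by case=> -[h1 h2 h3 h4] _; split=> *; [exact: h1|exact: h2|exact: h3|exact: h4]. Qed.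

Lemma rip_CS r x y : is_rip r -> `|r x y| <= nrm x * nrm y.
Proof.
move=> hr; rewrite -[nrm x]mul1r; apply: (@hform_bound setT) => //; first exact: hr.1.
by move=> z _; rewrite mul1r hr.2 lexx sqr_ge0.
Qed.

End Forms.

Lemma rip_ext (R : realType) (V : normedModType R[i]) (r : V -> V -> R) u v :
  is_rip r -> (forall x, r u x = r v x) -> u = v.
Proof.
move=> hr h; apply/eqP; rewrite -subr_eq0; apply/eqP/nrm_eq0/eqP.
rewrite -sqrf_eq0 -hr.2 (hformBl (@subspaceT _ V) hr.1) // h subrr //.
Qed.

Lemma hilbert_rip (R : realType) (V : completeNormedModType R[i]) :
  hilbert_norm V -> exists r : V -> V -> R, is_rip r.
Proof.
case=> ip [ipL ipC ipE].
have ip0 z : ip 0 z = 0.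
  have /eqP := ipL 1 0 0 z; rewrite scale1r addr0 mul1r.
  by rewrite -subr_eq0 opprD addNKr oppr_eq0 => /eqP.
have ipD x y z : ip (x + y) z = ip x z + ip y z.
  by rewrite -[x in LHS]scale1r ipL mul1r.
have ipZ a x z : ip (a *: x) z = a * ip x z.
  by rewrite -[_ *: _]addr0 ipL ip0 addr0.
have ReJ (z : R[i]) : complex.Re z^* = complex.Re z by case: z.
exists (fun x y => complex.Re (ip x y)); split; [split|].
- by move=> x y z _ _ _; rewrite ipD raddfD.
- by move=> x y _ _; rewrite ipC ReJ.
- move=> a x y _ _; congr complex.Re.
  by rewrite ipZ [RHS]ipC ipZ rmorphM /= -ipC conjCK.
- move=> a x y _ _; rewrite ipZ.
  by case: (ip x y) => u v /=; rewrite mul0r subr0.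
- by move=> x; rewrite ipE normE /rC -rmorphXn.
Qed.

Section Riesz.
Variables (R : realType) (V : completeNormedModType R[i]) (r : V -> V -> R).
Hypothesis hr : is_rip r.
Variables (D : set V) (sD : Defs.subspace D).
Let hrD : hform D r := rip_hform D hr.
Let hrT : hform setT r := hr.1.
Let sT := @subspaceT R V.

Lemma rip_sqrD x y : nrm (x + y) ^+ 2 = nrm x ^+ 2 + 2 * r x y + nrm y ^+ 2.
Proof. by rewrite -!(ripE hr) (hform_sqrD sT hrT). Qed.

Lemma rip_sqrB x y : nrm (x - y) ^+ 2 = nrm x ^+ 2 - 2 * r x y + nrm y ^+ 2.
Proof. by rewrite -!(ripE hr) (hform_sqrB sT hrT). Qed.

Lemma cvg_ripl (T : Type) (F : set_system T) {FF : Filter F} (f : T -> V) l x :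
  f @ F --> l -> r (f t) x @[t --> F] --> r l x.
Proof.
move=> /cvg_nrmP fl; apply/cvg_distP0.
have : nrm (f t - l) * nrm x @[t --> F] --> (0 : R).
  by rewrite -[0](mul0r (nrm x)); apply: cvgMl.
apply: squeeze0; apply: nearW => t; rewrite normr_ge0 /=.
by rewrite -(hformBl sT hrT) // rip_CS.
Qed.

(** The vector [y] is the limit of a minimising sequence in [D] of $J(x)=\|x\|^2-2\varphi(x)$. Real
    linearity on [D] suffices, and [D] need not be closed: [y] is only found in its closure. *)
Lemma riesz (phi : V -> R) (M : R) :
  (forall x y, D x -> D y -> phi (x + y) = phi x + phi y) ->
  (forall (a : R) x, D x -> phi (rC a *: x) = a * phi x) ->
  (forall x, D x -> `|phi x| <= M * nrm x) ->
  exists y, forall x, D x -> phi x = r y x.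
Proof.
move=> phiD phiZ phiM.
pose J x := nrm x ^+ 2 - 2 * phi x.
have phiN x : D x -> phi (- x) = - phi x.
  move=> Dx; have -> : - x = rC (-1) *: x by rewrite /rC rmorphN rmorph1 scaleN1r.
  by rewrite phiZ // mulN1r.
have Jlb x : D x -> - M ^+ 2 <= J x.
  move=> Dx; have := phiM _ Dx; rewrite /J ler_norml => /andP[_ h].
  by have := sqr_ge0 (nrm x - M); nra.
have hinf : has_inf (J @` D).
  split; first by exists (J 0), 0 => //; exact: sub0.
  by exists (- M ^+ 2) => _ [x Dx <-]; exact: Jlb.
pose m := inf (J @` D).
have Jm x : D x -> m <= J x.
  by move=> Dx; apply: ge_inf; [exact: hinf.2 | exists x].
have /choice[u hu] (n : nat) : exists x, D x /\ J x < m + n.+1%:R^-1.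
  have n0 : 0 < n.+1%:R^-1 :> R by rewrite invr_gt0.
  by have [_ [x Dx <-] ?] := inf_adherent n0 hinf; exists x.
have JD x y (t : R) : D x -> D y ->
    J (x + rC t *: y) = J x + 2 * t * (r x y - phi y) + t ^+ 2 * nrm y ^+ 2.
  move=> Dx Dy; have DZ := subZ sD (rC t) Dy.
  rewrite /J phiD // phiZ // rip_sqrD nrmZ exprMn real_normK ?num_real //.
  by rewrite (hformZr sD hrD) //; ring.
(* Parallelogram argument: at the midpoint, [J] is the average of [J (u n)] and [J (u k)] minus a
   quarter of the squared distance, and it is still at least [m]. *)
have uc n k : nrm (u n - u k) ^+ 2 <= 2 * (n.+1%:R^-1 + k.+1%:R^-1).
  have [Dn Jn] := hu n; have [Dk Jk] := hu k.
  have := Jm _ (subD sD Dn (subZ sD (rC 2^-1) (subB sD Dk Dn))).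
  rewrite JD //; last exact: subB.
  rewrite (phiD (u k) (- u n)) ?phiN //; last exact: subN.
  rewrite nrmB (hformBr sD hrD) // ripE //.
  move: Jn Jk; rewrite /J rip_sqrB.
  have -> : 2 / 2 = 1 :> R by field.
  have -> : 2^-1 ^+ 2 = 1 / 4 :> R by field.
  move: (n.+1%:R^-1) (k.+1%:R^-1) (r _ _) (phi _) (phi _) (nrm _ ^+ 2) (nrm _ ^+ 2) => *; lra.
have [y uy] : exists y : V, u n @[n --> \oo] --> y.
  apply: cvg_of_cauchy => e e0.
  have e2 : 0 < e ^+ 2 / 4 by rewrite divr_gt0 ?exprn_gt0.
  have /cvgrPdist_lt/(_ _ e2)[N _ hN] := @cvg_harmonic R.
  have hN' n : (N <= n)%N -> n.+1%:R^-1 < e ^+ 2 / 4.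
    by move/hN; rewrite /= sub0r normrN /harmonic ger0_norm ?invr_ge0.
  exists N => n k Nn Nk; rewrite -(@ltr_pXn2r _ 2) ?nnegrE ?nrm_ge0 ?ltW //.
  apply: le_lt_trans (uc n k) _; have := hN' _ Nn; have := hN' _ Nk.
  by move: (n.+1%:R^-1) (k.+1%:R^-1) => *; lra.
exists y => x Dx.
(* Since [J (u n + t x) >= m] for every real [t], a quadratic in [t] is non-negative and its
   discriminant bounds the defect of [u n] as a representing vector. *)
have hx n : (r (u n) x - phi x) ^+ 2 <= n.+1%:R^-1 * nrm x ^+ 2.
  have [Dn Jn] := hu n; apply: quadratic_discr => [|t]; first exact: sqr_ge0.
  have := Jm _ (subD sD Dn (subZ sD (rC t) Dx)); rewrite JD //.
  by move: Jn; move: (n.+1%:R^-1) => *; lra.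
suff : (r (u n) x - phi x) ^+ 2 @[n --> \oo] --> (0 : R).
  move=> c1; have c2 : (r (u n) x - phi x) ^+ 2 @[n --> \oo] --> (r y x - phi x) ^+ 2.
    by rewrite expr2; under eq_fun do rewrite expr2; apply: cvgM;
      (apply: cvgB; [exact: cvg_ripl | exact: cvg_cst]).
  apply/esym/eqP; rewrite -subr_eq0 -sqrf_eq0; apply/eqP.
  exact: (cvg_unique (@Rhausdorff R) c2 c1).
have : n.+1%:R^-1 * nrm x ^+ 2 @[n --> \oo] --> (0 : R).
  by rewrite -[0](mul0r (nrm x ^+ 2)); apply: cvgMl; exact: cvg_harmonic.
by apply: squeeze0; apply: nearW => n; rewrite sqr_ge0 hx.
Qed.

End Riesz.

(** * Bounded forms, Neumann series and square roots *)

Definition linear_op (R : realType) (V W : normedModType R[i]) (L : V -> W) :=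
  forall (a : R[i]) (x y : V), L (a *: x + y) = a *: L x + L y.

Section LinearOp.
Variables (R : realType) (V W : normedModType R[i]) (L : V -> W).
Hypothesis linL : linear_op L.

Lemma lop0 : L 0 = 0.
Proof.
have := linL 1 0 0; rewrite !scale1r addr0 => /eqP.
by rewrite -subr_eq0 opprD addNKr oppr_eq0 => /eqP.
Qed.

Lemma lopZ a x : L (a *: x) = a *: L x.
Proof. by rewrite -[a *: x]addr0 linL lop0 addr0. Qed.

Lemma lopD x y : L (x + y) = L x + L y.
Proof. by rewrite -[x in LHS]scale1r linL scale1r. Qed.

Lemma lopN x : L (- x) = - L x.
Proof. by rewrite -scaleN1r lopZ scaleN1r. Qed.

Lemma lopB x y : L (x - y) = L x - L y.
Proof. by rewrite lopD lopN. Qed.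

Lemma lop_cvg (M : R) (T : Type) (F : set_system T) {FF : Filter F} (f : T -> V) l :
  (forall x, nrm (L x) <= M * nrm x) -> f @ F --> l -> L (f t) @[t --> F] --> L l.
Proof.
move=> LM /cvg_nrmP fl; apply/cvg_nrmP.
have : M * nrm (f t - l) @[t --> F] --> (0 : R) by rewrite -(mulr0 M); apply: cvgMr.
by apply: squeeze0; apply: nearW => t; rewrite nrm_ge0 -lopB LM.
Qed.

End LinearOp.

Lemma hform_lop (R : realType) (V W : normedModType R[i]) (L : V -> W) r D :
  linear_op L -> is_rip r -> hform D (fun x y => r (L x) (L y)).
Proof.
move=> linL hr; have [hD hC hJ hZ] := hr.1.
split=> [x y z|x y|a x y|a x y] _ _ *.
- by rewrite lopD // hD.
- by rewrite hC.
- by rewrite !lopZ // hJ.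
- by rewrite lopZ // hZ.
Qed.

Lemma ler_eps (R : realType) (a b c : R) :
  (forall e, 0 < e -> a <= b + e * c) -> a <= b.
Proof.
move=> h; apply/ler_addgt0Pr => e e0.
have c0 : 0 < `|c| + 1 by rewrite ltr_pwDr.
apply: le_trans (h (e / (`|c| + 1)) _) _; first by rewrite divr_gt0.
rewrite lerD2l mulrAC ler_pdivrMr // ler_pM2l //.
by rewrite (le_trans (ler_norm c)) // lerDl.
Qed.

Section DenseForm.
Variables (R : realType) (V : completeNormedModType R[i]) (r : V -> V -> R).
Hypothesis hr : is_rip r.
Variables (D : set V).
Hypotheses (sD : Defs.subspace D) (dD : dense D).
Let hrD : hform D r := rip_hform D hr.
Let hrT : hform setT r := hr.1.
Let sT := @subspaceT R V.

Lemma dense_approx x (e : R) : 0 < e -> exists2 d, D d & nrm (x - d) < e.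
Proof.
move=> e0; have e0' : 0 < rC e by rewrite (_ : 0 = rC 0) // ltr_rC.
have [||d [+ Dd]] := dD (O := ball x (rC e)).
- by exists x; exact: ballxx.
- exact: ball_open.
by rewrite -ball_normE /= normE ltr_rC; exists d.
Qed.

Lemma dense_zero (psi : V -> R) (c : R) :
  (forall x y, psi (x - y) = psi x - psi y) -> (forall x, `|psi x| <= c * nrm x) ->
  (forall x, D x -> psi x = 0) -> forall x, psi x = 0.
Proof.
move=> psiB psic psi0 x; apply/eqP; rewrite -normr_le0.
apply: (@ler_eps _ _ _ `|c|) => e e0; rewrite add0r.
have [d Dd xd] := dense_approx x e0.
rewrite -[psi x]subr0 -(psi0 d Dd) -psiB (le_trans (psic _)) //.
rewrite (le_trans (ler_wpM2r (nrm_ge0 _) (ler_norm c))) // mulrC.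
by rewrite ler_wpM2r // ltW.
Qed.

Lemma rip_ext_dense u v : (forall x, D x -> r u x = r v x) -> u = v.
Proof.
move=> h; apply: (rip_ext hr) => x; apply/eqP; rewrite -subr_eq0; apply/eqP.
rewrite -(hformBl sT hrT) //.
apply: (@dense_zero (r (u - v)) (nrm (u - v))) => [y z|y|y Dy].
- by rewrite (hformBr sT hrT).
- exact: rip_CS.
- by rewrite (hformBl sT hrT) // h // subrr.
Qed.

Lemma nrm_le_dense u (K : R) : 0 <= K ->
  (forall x, D x -> `|r u x| <= K * nrm x) -> nrm u <= K.
Proof.
move=> K0 h; have [->//|u0] := eqVneq (nrm u) 0.
have {}u0 : 0 < nrm u by rewrite lt_def u0 nrm_ge0.
rewrite -(ler_pM2r u0) -expr2; apply: (@ler_eps _ _ _ (K + nrm u)) => e e0.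
have [d Dd ud] := dense_approx u e0.
have -> : nrm u ^+ 2 = r u d + r u (u - d).
  by rewrite (hformBr sT hrT) // addrC subrK ripE.
have := h d Dd; have := rip_CS u (u - d) hr; have := ler_nrmD u (d - u).
rewrite addrCA subrr addr0 nrmB.
by rewrite !ler_norml => h1 /andP[_ h2] /andP[_ h3]; nra.
Qed.

(** Riesz on [D] represents [b x] by a vector [P0 x], but only for [x] in [D]. Complex linearity
    comes from the clause that moves a scalar, conjugated, to the other argument. *)
Lemma op_of_form (b : V -> V -> R) (M : R) : hform D b -> 0 <= M ->
  (forall x y, D x -> D y -> `|b x y| <= M * nrm x * nrm y) ->
  exists B : V -> V, [/\ linear_op B, forall x, nrm (B x) <= M * nrm x,
    forall x y, r (B x) y = r x (B y) & forall x y, D x -> D y -> b x y = r (B x) y].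
Proof.
move=> hb M0 bM.
have /choice[P0 hP0] x : exists y, D x -> forall z, D z -> b x z = r y z.
  have [Dx|nDx] := pselect (D x); last by exists 0.
  have [|||y hy] := @riesz _ _ r hr D sD (b x) (M * nrm x).
  - by move=> y z Dy Dz; rewrite (hformDr sD hb).
  - by move=> a z Dz; rewrite (hformZr sD hb).
  - by move=> z; exact: bM.
  - by exists y.
have P0D x y : D x -> D y -> P0 (x + y) = P0 x + P0 y.
  move=> Dx Dy; apply: rip_ext_dense => z Dz.
  rewrite -hP0 ?(hformDl hb) ?(hformDl hrT) -?hP0 //; exact: subD.
have P0J a x : D x -> P0 (a *: x) = a *: P0 x.
  move=> Dx; apply: rip_ext_dense => z Dz; have DZ := subZ sD a^* Dz.
  by rewrite -hP0 ?(hformJ hb) ?(hformJ hrT) -?hP0 //; exact: subZ.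
have P0M x : D x -> nrm (P0 x) <= M * nrm x.
  move=> Dx; apply: nrm_le_dense => [|z Dz]; first by rewrite mulr_ge0 ?nrm_ge0.
  by rewrite -hP0 // bM.
(* A second use of Riesz defines the adjoint of [P0] on all of [V]. By symmetry of [b] it agrees
   with [P0] on [D], so it is the bounded extension, obtained without Cauchy sequences. *)
have /choice[P hP] z : exists w, forall x, D x -> r (P0 x) z = r w x.
  apply: (@riesz _ _ r hr D sD _ (M * nrm z)).
  - by move=> x y Dx Dy; rewrite P0D // (hformDl hrT).
  - by move=> a x Dx; rewrite P0J // (hformZl hrT).
  - move=> x Dx; apply: le_trans (rip_CS _ _ hr) _.
    by rewrite mulrAC ler_wpM2r ?nrm_ge0 ?P0M.
have PM x : nrm (P x) <= M * nrm x.
  apply: nrm_le_dense => [|z Dz]; first by rewrite mulr_ge0 ?nrm_ge0.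
  rewrite -hP // (le_trans (rip_CS _ _ hr)) // mulrAC ler_wpM2r ?nrm_ge0 //.
  exact: P0M.
have PP0 x : D x -> P x = P0 x.
  move=> Dx; apply: rip_ext_dense => z Dz.
  by rewrite -hP // -hP0 // (hformC hb) // hP0.
have Plin : linear_op P.
  move=> a x y; apply: rip_ext_dense => z Dz; have DZ := subZ sD a^* Dz.
  rewrite -hP // (hformDr sT hrT) // (hformDl hrT) //; congr (_ + _); last exact: hP.
  by rewrite (hformJ hrT) // -hP // P0J // (hformJ hrT) // conjCK.
exists P; split => //; last by move=> x y Dx Dy; rewrite PP0 // hP0.
move=> x y; apply/eqP; rewrite -subr_eq0; apply/eqP.
apply: (@dense_zero (fun y => r (P x) y - r x (P y)) (2 * M * nrm x)).
- by move=> z w; rewrite !(hformBr sT hrT) // lopB // (hformBr sT hrT) //; ring.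
- move=> z; apply: le_trans (ler_normB _ _) _.
  have -> : 2 * M * nrm x * nrm z = M * nrm x * nrm z + nrm x * (M * nrm z) by ring.
  apply: lerD; apply: le_trans (rip_CS _ _ hr) _.
    by rewrite ler_wpM2r ?nrm_ge0 ?PM.
  by rewrite ler_wpM2l ?nrm_ge0 ?PM.
- by move=> z Dz; rewrite -hP // PP0 // (hformC hrT) // subrr.
Qed.

End DenseForm.

Section Neumann.
Variables (R : realType) (V : completeNormedModType R[i]) (L : V -> V) (q : R).
Hypotheses (linL : linear_op L) (Lq : forall x, nrm (L x) <= q * nrm x).
Hypotheses (q0 : 0 <= q) (q1 : q < 1).

(** The map $1-L$ is bounded below by $1-q$, which gives injectivity and the bound on the inverse.
    Surjectivity comes from iterating $u\mapsto z+Lu$, whose increments are dominated by a geometric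
    series. *)
Lemma neumann : exists G : V -> V, [/\ bounded_op G,
  forall x, G (x - L x) = x & forall x, G x - L (G x) = x].
Proof.
have q1' : 0 < 1 - q by rewrite subr_gt0.
have lower x : (1 - q) * nrm x <= nrm (x - L x).
  have := ler_nrmD (x - L x) (L x); rewrite subrK.
  by have := Lq x; lra.
have inj x : x - L x = 0 -> x = 0.
  move=> x0; apply: nrm_eq0; apply/eqP; rewrite eq_le nrm_ge0 andbT.
  by rewrite -(ler_pM2l q1') mulr0; have := lower x; rewrite x0 nrm0.
have /choice[G hG] z : exists x, x - L x = z.
  pose u := fix u n := if n is m.+1 then z + L (u m) else 0.
  have ud n : nrm (u n.+1 - u n) <= q ^+ n * nrm z.
    elim: n => [|n IH]; first by rewrite /= lop0 // addr0 subr0 expr0 mul1r.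
    rewrite [u n.+2]/= [u n.+1 in X in _ - X]/= opprD addrACA subrr add0r -(lopB linL).
    by rewrite (le_trans (Lq _)) // exprS -mulrA ler_wpM2l.
  have [||x ux] := @cvg_majorized _ _ u (fun n => nrm z * (1 - q ^+ n) / (1 - q))
      (nrm z / (1 - q)).
  - move=> n; apply: le_trans (ud n) _; rewrite le_eqVlt; apply/orP; left; apply/eqP.
    by rewrite exprS; field; rewrite gt_eqF.
  - move=> n; rewrite ler_pM2r ?invr_gt0 // ler_piMr ?nrm_ge0 //.
    by rewrite gerBl exprn_ge0.
  exists x; have u1 : u n.+1 @[n --> \oo] --> x by rewrite (cvg_shiftS u).
  have u2 : u n.+1 @[n --> \oo] --> z + L x.
    by apply: cvgD; [exact: cvg_cst | exact: (lop_cvg linL Lq ux)].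
  by rewrite {1}(cvg_unique (@norm_hausdorff _ V) u1 u2) addrK.
have GK x : G (x - L x) = x.
  apply/eqP; rewrite -subr_eq0; apply/eqP/inj; rewrite (lopB linL) opprD opprK addrACA hG.
  by rewrite [- x + _]addrC subrKA subrr.
exists G; split => //; apply/bounded_op_nrm; split.
  move=> a x y; rewrite -[RHS]GK; congr G.
  by rewrite linL opprD addrACA -scalerBr !hG.
exists (1 - q)^-1 => [|x]; first by rewrite invr_ge0 ltW.
by rewrite mulrC ler_pdivlMr // mulrC -{2}(hG x); exact: lower.
Qed.

End Neumann.

(* [Y] solves [2 Y = B + Y ^ 2], i.e. [(1 - Y) ^ 2 = 1 - B]; the iteration for [Y] is dominated in norm
   by the scalar iteration [a] for the same equation with [B] replaced by [q]. *)
Section SquareRoot.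
Variables (R : realType) (V : completeNormedModType R[i]) (r : V -> V -> R).
Hypothesis hr : is_rip r.
Variables (B : V -> V) (q : R).
Hypotheses (linB : linear_op B) (Bq : forall x, nrm (B x) <= q * nrm x).
Hypotheses (Bsym : forall x y, r (B x) y = r x (B y)) (q0 : 0 <= q) (q1 : q <= 1).
Let hrT : hform setT r := hr.1.
Let sT := @subspaceT R V.

Fixpoint sqrt_iter n x : V :=
  if n is m.+1 then rC 2^-1 *: (B x + sqrt_iter m (sqrt_iter m x)) else 0.

Fixpoint sqrt_bound n : R :=
  if n is m.+1 then 2^-1 * (q + sqrt_bound m ^+ 2) else 0.

Let Y := sqrt_iter.
Let a := sqrt_bound.

Lemma sqrt_bound_ge0 n : 0 <= a n.
Proof. by case: n => [|n] //=; rewrite mulr_ge0 ?addr_ge0 ?sqr_ge0. Qed.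

(** The case [q = 1] is included: the increments of [a] then need not decay geometrically, but [a]
    is still bounded, which is all that [cvg_majorized] asks. *)
Lemma sqrt_bound_le n : a n <= q.
Proof.
elim: n => [//|n IH] /=; have := sqrt_bound_ge0 n; rewrite -/a => an.
have : a n ^+ 2 <= q by rewrite expr2 (le_trans (ler_piMr an (le_trans IH q1))).
by rewrite -/a; move: (a n ^+ 2) => s; lra.
Qed.

Lemma sqrt_bound_homo n : a n <= a n.+1.
Proof.
elim: n => [|n IH]; first exact: sqrt_bound_ge0.
rewrite [a n.+2]/= {1}[a n.+1]/= ler_wpM2l ?invr_ge0 // lerD2l ler_sqr ?nnegrE //;
  [exact: sqrt_bound_ge0 | exact: (sqrt_bound_ge0 n.+1)].
Qed.

Lemma sqrt_iter_linear n : linear_op (Y n).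
Proof.
elim: n => [c x y|n IH c x y] /=; first by rewrite scaler0 addr0.
rewrite linB -/Y !IH // addrACA -scalerDr [LHS]scalerDr !scalerA; congr (_ + _).
by rewrite mulrC.
Qed.

Lemma sqrt_iter_sym n x y : r (Y n x) y = r x (Y n y).
Proof.
have h0 z : r 0 z = 0 by rewrite -(subrr z) (hformBl sT hrT) // subrr.
elim: n x y => [|n IH] x y /=; first by rewrite [r x 0](hformC hrT) // !h0.
rewrite (hformZl hrT) // (hformZr sT hrT) //; congr (_ * _).
by rewrite (hformDl hrT) // (hformDr sT hrT) // Bsym -/Y !IH.
Qed.

Lemma sqrt_iter_bound n x : nrm (Y n x) <= a n * nrm x.
Proof.
elim: n x => [|n IH] x /=; first by rewrite nrm0 mul0r.
rewrite nrmZ ger0_norm ?invr_ge0 // -mulrA ler_wpM2l ?invr_ge0 // mulrDl.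
rewrite (le_trans (ler_nrmD _ _)) // lerD // -/Y (le_trans (IH _)) //.
by rewrite expr2 -mulrA ler_wpM2l // sqrt_bound_ge0.
Qed.

(** The factorisation $Y_{n+1}^2-Y_n^2=Y_{n+1}(Y_{n+1}-Y_n)+(Y_{n+1}-Y_n)Y_n$ holds without
    commutation, and the scalars [a] satisfy the same identity. *)
Lemma sqrt_iter_diff n x : nrm (Y n.+1 x - Y n x) <= (a n.+1 - a n) * nrm x.
Proof.
elim: n x => [|n IH] x.
  rewrite /= subr0 addr0 nrmZ ger0_norm ?invr_ge0 // expr0n /= addr0 subr0 -mulrA.
  by rewrite ler_wpM2l // invr_ge0.
have -> : Y n.+2 x - Y n.+1 x = rC 2^-1 *:
    (Y n.+1 (Y n.+1 x - Y n x) + (Y n.+1 (Y n x) - Y n (Y n x))).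
  rewrite (lopB (sqrt_iter_linear n.+1)) subrKA [Y n.+2]/= [Y n.+1 in X in _ - X]/=.
  by rewrite -scalerBr opprD addrACA subrr add0r.
have -> : a n.+2 - a n.+1 = 2^-1 * (a n.+1 * (a n.+1 - a n) + (a n.+1 - a n) * a n).
  have aS m : a m.+1 = 2^-1 * (q + a m ^+ 2) by [].
  by rewrite (aS n.+1) (aS n); ring.
rewrite nrmZ ger0_norm ?invr_ge0 // -mulrA ler_wpM2l ?invr_ge0 // mulrDl.
rewrite (le_trans (ler_nrmD _ _)) // lerD //.
  rewrite (le_trans (sqrt_iter_bound _ _)) // -mulrA ler_wpM2l //.
  exact: sqrt_bound_ge0.
rewrite (le_trans (IH _)) // -mulrA ler_wpM2l ?sqrt_iter_bound //.
by rewrite subr_ge0 sqrt_bound_homo.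
Qed.

Lemma square_root : exists Y : V -> V, [/\ linear_op Y, forall x, nrm (Y x) <= q * nrm x
  & forall x, nrm (x - Y x) ^+ 2 = r (x - B x) x].
Proof.
have /choice[Z hZ] x : exists l : V, Y n x @[n --> \oo] --> l.
  apply: (@cvg_majorized _ _ _ (fun n => a n * nrm x) (q * nrm x)) => n.
    by rewrite -mulrBl; exact: sqrt_iter_diff.
  by rewrite ler_wpM2r ?nrm_ge0 ?sqrt_bound_le.
have hV := @norm_hausdorff _ V.
have linZ : linear_op Z.
  move=> c x y; apply: (cvg_unique hV (hZ (c *: x + y))).
  have -> : (fun n => Y n (c *: x + y)) = (fun n => c *: Y n x + Y n y).
    by apply/funext => n; exact: sqrt_iter_linear.
  by apply: cvgD (hZ y); apply: cvgZr; exact: hZ.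
have Yq n x : nrm (Y n x) <= q * nrm x.
  by rewrite (le_trans (sqrt_iter_bound _ _)) // ler_wpM2r ?nrm_ge0 ?sqrt_bound_le.
have Zq x : nrm (Z x) <= q * nrm x.
  by apply: (cvgr_to_le (cvg_nrm (hZ x))); apply: nearW => n; exact: Yq.
have Zsym x y : r (Z x) y = r x (Z y).
  have c1 : r (Y n x) y @[n --> \oo] --> r (Z x) y by exact: cvg_ripl.
  have c2 : r (Y n x) y @[n --> \oo] --> r x (Z y).
    have -> : (fun n => r (Y n x) y) = (fun n => r (Y n y) x).
      by apply/funext => n; rewrite sqrt_iter_sym (hformC hrT).
    by rewrite (hformC hrT) //; exact: cvg_ripl.
  exact: (cvg_unique (@Rhausdorff R) c1 c2).
have ZZ x : B x + Z (Z x) = rC 2 *: Z x.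
  (* Inner and outer factor vary together; the uniform bound [q <= 1] on [Y n] controls the inner
     error. *)
  have YY : Y n (Y n x) @[n --> \oo] --> Z (Z x).
    apply/cvg_nrmP.
    have : nrm (Y n x - Z x) + nrm (Y n (Z x) - Z (Z x)) @[n --> \oo] --> (0 : R).
      by rewrite -[0]addr0; apply: cvgD; apply/cvg_nrmP; exact: hZ.
    apply: squeeze0; apply: nearW => n; rewrite nrm_ge0 /=.
    rewrite -(subrKA (Y n (Z x))) (le_trans (ler_nrmD _ _)) // lerD2r.
    rewrite -(lopB (sqrt_iter_linear n)) (le_trans (Yq _ _)) //.
    by rewrite ler_piMl ?nrm_ge0.
  have c1 : rC 2^-1 *: (B x + Y n (Y n x)) @[n --> \oo] --> rC 2^-1 *: (B x + Z (Z x)).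
    by apply: cvgZr; apply: cvgD YY; exact: cvg_cst.
  have c2 : Y n.+1 x @[n --> \oo] --> Z x by rewrite (cvg_shiftS (Y^~ x)); exact: hZ.
  have -> : B x + Z (Z x) = rC 2 *: (rC 2^-1 *: (B x + Z (Z x))).
    by rewrite scalerA -rCM divff ?pnatr_eq0 // /rC rmorph1 scale1r.
  by congr (_ *: _); exact: (cvg_unique hV c1 c2).
exists Z; split => // x.
(* By symmetry of [Z] the left side is $\langle(1-Z)^2x,x\rangle$, and $(1-Z)^2=1-2Z+Z^2=1-B$. *)
rewrite -(ripE hr) (hformBr sT hrT) // -Zsym -(hformBl sT hrT) //; congr (r _ x).
have -> : B x = rC 2 *: Z x - Z (Z x) by rewrite -ZZ addrK.
rewrite (lopB linZ) !opprB /rC (rmorphD _ 1 1) rmorph1 scalerDl scale1r opprD.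
by rewrite [RHS]addrCA [LHS]addrC -!addrA; congr (_ + _); rewrite addrCA.
Qed.

End SquareRoot.

(** * Invariant means *)

(** The form $r-b/c$ lies between $0$ and $q=1-al/c$ times the squared norm. If $B$ represents it
    and $(1-Y)^2=1-B$, then $S=\sqrt c\,(1-Y)$. For [al > 0] the bound $q<1$ on $Y$ lets the Neumann
    series invert $S$; [al = 0] is the case of the dissipation form. *)
Lemma form_root (R : realType) (V : completeNormedModType R[i]) (r : V -> V -> R)
    (D : set V) (b : V -> V -> R) (al c : R) :
  is_rip r -> Defs.subspace D -> dense D -> hform D b -> 0 <= al -> al <= c -> 0 < c ->
  (forall x, D x -> al * nrm x ^+ 2 <= b x x <= c * nrm x ^+ 2) ->
  exists S : V -> V, [/\ bounded_op S, forall x, D x -> nrm (S x) ^+ 2 = b x x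
    & 0 < al -> exists S' : V -> V, [/\ bounded_op S', cancel S S' & cancel S' S]].
Proof.
move=> hr sD dD hb al0 alc c0 hbb.
pose q := 1 - al / c.
have q0 : 0 <= q by rewrite subr_ge0 ler_pdivrMr // mul1r.
have q1 : q <= 1 by rewrite gerBl divr_ge0 // ltW.
pose b' x y := r x y - c^-1 * b x y.
have hb' : hform D b'.
  have [hD hC hJ hZ] := hb; have [rD rC' rJ rZ] := rip_hform D hr.
  split=> [x y z|x y|a x y|a x y] *; rewrite /b'.
  - by rewrite hD // rD //; ring.
  - by rewrite hC // rC'.
  - by rewrite hJ // rJ.
  - by rewrite hZ // rZ //; ring.
have b'q z : D z -> 0 <= b' z z <= q * nrm z ^+ 2.
  move=> Dz; have /andP[h1 h2] := hbb z Dz; rewrite /b' ripE //; apply/andP; split.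
    by rewrite subr_ge0 -ler_pdivlMl ?invr_gt0 // invrK.
  by rewrite /q mulrBl mul1r lerD2l lerN2 mulrAC ler_pdivrMr // mulrAC mulVf ?gt_eqF // mul1r.
have [B [linB Bq Bsym Bb]] := op_of_form hr sD dD hb' q0
  (fun x y => @hform_bound _ _ D b' sD hb' x y q q0 b'q).
have [Y [linY Yq Ysq]] := square_root hr linB Bq Bsym q0 q1.
pose k := Num.sqrt c.
have k0 : 0 < k by rewrite sqrtr_gt0.
have YM x : nrm (x - Y x) <= (1 + q) * nrm x.
  by rewrite (le_trans (ler_nrmB _ _)) // mulrDl mul1r lerD2l.
have linS : linear_op (fun x => x - Y x).
  by move=> a x y; rewrite linY opprD addrACA scalerBr.
exists (fun x => rC k *: (x - Y x)); split.
- apply/bounded_op_nrm; split.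
    by move=> a x y; rewrite linS scalerDr !scalerA mulrC.
  exists (k * (1 + q)) => [|x]; first by apply: mulr_ge0; [exact: ltW | exact: addr_ge0].
  by rewrite nrmZ gtr0_norm // -mulrA ler_pM2l.
- move=> x Dx; rewrite nrmZ gtr0_norm // exprMn Ysq sqr_sqrtr ?ltW //.
  rewrite (hformBl (@subspaceT _ V) hr.1) // -Bb // /b' opprB addrC subrK mulrA divff ?mul1r //.
  by rewrite gt_eqF.
- move=> al1; have q1' : q < 1 by rewrite ltrBlDr ltrDl divr_gt0.
  have [G [/bounded_op_nrm[linG [M M0 GM]] GK KG]] := neumann linY Yq q0 q1'.
  exists (fun x => G (rC k^-1 *: x)); split.
  + apply/bounded_op_nrm; split.
      by move=> a x y; rewrite -linG scalerDr !scalerA mulrC.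
    exists (M * k^-1) => [|x]; first by rewrite mulr_ge0 // invr_ge0 ltW.
    rewrite (le_trans (GM _)) // nrmZ ger0_norm ?mulrA //.
    by rewrite invr_ge0 ltW.
  + by move=> x; rewrite scalerA -rCM mulVf ?gt_eqF // /rC rmorph1 scale1r GK.
  + by move=> x; rewrite KG scalerA -rCM divff ?gt_eqF // /rC rmorph1 scale1r.
Qed.

(* The mean is taken over dyadic grids, so it is only invariant under dyadic translations;
   strong continuity of the semigroup makes up for that. *)
Section InvariantMean.
Variable R : realType.
Implicit Types f g : R -> R.

(** The $4^n$ nodes of mesh $2^{-n}$ fill $[0,2^n)$. The mesh shrinks, so a dyadic shift is
    eventually a whole number of nodes, while the window grows, so that such a shift becomes
    negligible. *)
Definition dyadic_mean n f : R := (4 ^ n)%:R^-1 * \sum_(k < 4 ^ n) f (k%:R / 2 ^+ n).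

Definition bounded_nneg f := exists M, forall t, 0 <= t -> `|f t| <= M.

Let grid_ge0 (k n : nat) : 0 <= k%:R / 2 ^+ n :> R.
Proof. by rewrite divr_ge0 ?exprn_ge0. Qed.

Let four_gt0 n : 0 < (4 ^ n)%:R :> R.
Proof. by rewrite ltr0n expn_gt0. Qed.

Lemma dyadic_meanD n f g :
  dyadic_mean n (fun t => f t + g t) = dyadic_mean n f + dyadic_mean n g.
Proof. by rewrite /dyadic_mean big_split mulrDr. Qed.

Lemma dyadic_meanZ n a f : dyadic_mean n (fun t => a * f t) = a * dyadic_mean n f.
Proof. by rewrite /dyadic_mean -mulr_sumr mulrCA. Qed.

Lemma dyadic_mean_cst n c : dyadic_mean n (fun=> c) = c.
Proof.
by rewrite /dyadic_mean sumr_const card_ord -[c *+ _]mulr_natl mulKf // gt_eqF.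
Qed.

Lemma dyadic_mean_le n f g : (forall t, 0 <= t -> f t <= g t) ->
  dyadic_mean n f <= dyadic_mean n g.
Proof.
move=> fg; rewrite ler_pM2l ?invr_gt0 //; apply: ler_sum => k _.
exact/fg/grid_ge0.
Qed.

Lemma dyadic_mean_bound n f M : (forall t, 0 <= t -> `|f t| <= M) ->
  `|dyadic_mean n f| <= M.
Proof.
move=> fM; rewrite ler_norml -{1}(dyadic_mean_cst n (- M)) -{2}(dyadic_mean_cst n M).
by apply/andP; split; apply: dyadic_mean_le => t /fM; rewrite ler_norml => /andP[].
Qed.

(** Each shift by one node telescopes: it changes the sum by two boundary values only, hence by at
    most [2 * M]. *)
Lemma dyadic_mean_shift n f M J : (forall t, 0 <= t -> `|f t| <= M) ->
  `|dyadic_mean n (fun t => f (t + J%:R / 2 ^+ n)) - dyadic_mean n f|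
    <= (4 ^ n)%:R^-1 * (2 * M * J%:R).
Proof.
move=> fM; rewrite /dyadic_mean -mulrBr normrM ger0_norm ?invr_ge0 // ler_pM2l ?invr_gt0 //.
elim: J => [|J IH].
  by under eq_bigr do rewrite mul0r addr0; rewrite subrr normr0 mulr0.
rewrite -(subrKA (\sum_(k < 4 ^ n) f (k%:R / 2 ^+ n + J%:R / 2 ^+ n))).
have -> : 2 * M * J.+1%:R = 2 * M + 2 * M * J%:R by rewrite -[J.+1]addn1 natrD; ring.
rewrite (le_trans (ler_normD _ _)) // lerD //.
rewrite -sumrB; under eq_bigr => k _ do rewrite -!mulrDl -!natrD addnS.
rewrite -(big_mkord xpredT (fun k => f ((k + J).+1%:R / 2 ^+ n) - f ((k + J)%:R / 2 ^+ n))).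
rewrite (telescope_sumr (fun k => f ((k + J)%:R / 2 ^+ n))) //.
have -> : 2 * M = M + M by ring.
by rewrite (le_trans (ler_normB _ _)) // lerD // fM.
Qed.

(** [L] is the limit of the dyadic means along an ultrafilter finer than convergence to infinity.
    Linearity and order pass to such limits, and shift invariance holds because the shift error
    tends to 0. *)
Lemma invariant_mean : exists L : (R -> R) -> R, [/\
  forall f g, bounded_nneg f -> bounded_nneg g -> L (fun t => f t + g t) = L f + L g,
  forall a f, bounded_nneg f -> L (fun t => a * f t) = a * L f,
  forall f g, bounded_nneg f -> bounded_nneg g ->
    (forall t, 0 <= t -> f t <= g t) -> L f <= L g,
  forall c, L (fun=> c) = c
  & forall f (j m : nat), bounded_nneg f -> L (fun t => f (t + j%:R / 2 ^+ m)) = L f].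
Proof.
have [G [UG sG]] := ultraFilterLemma eventually_filter.
have PG : ProperFilter G := @ultra_proper _ _ UG.
(* Functions unbounded on the half-line get the value 0; linearity and shift invariance are claimed
   for bounded ones only. *)
have Lex f : exists l : R, bounded_nneg f -> dyadic_mean n f @[n --> G] --> l.
  have [[M fM]|nf] := pselect (bounded_nneg f); last by exists 0.
  case: (@segment_compact R (- M) M (dyadic_mean n f @[n --> G])) => [|l [_ hl]].
    by apply: (@filterE nat G) => n; rewrite /= in_itv /= -ler_norml dyadic_mean_bound.
  (* A cluster point along an ultrafilter is a limit: otherwise the complement of [A] would be
     charged, and it would have to meet [A]. *)
  exists l => _ A /= Al; have [//|nA] := in_ultra_setVsetC [set n | A (dyadic_mean n f)] UG.
  by have [x []] := hl (~` A) A nA Al.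
have [L hL] := choice Lex.
have Lu f l : bounded_nneg f -> dyadic_mean n f @[n --> G] --> l -> L f = l.
  by move=> bf; apply: (cvg_unique (@Rhausdorff R)); exact: hL.
exists L; split.
- move=> f g bf bg; apply: Lu.
    have [M hM] := bf; have [N hN] := bg; exists (M + N) => t t0.
    by rewrite (le_trans (ler_normD _ _)) // lerD ?hM ?hN.
  under eq_fun do rewrite dyadic_meanD.
  by apply: cvgD; exact: hL.
- move=> a f bf; apply: Lu.
    by have [M hM] := bf; exists (`|a| * M) => t t0; rewrite normrM ler_wpM2l ?hM.
  under eq_fun do rewrite dyadic_meanZ.
  by apply: cvgMr; exact: hL.
- move=> f g bf bg fg; apply: ler_cvg_to (hL _ bf) (hL _ bg) _.
  by apply: nearW => n; exact: dyadic_mean_le.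
- move=> c; apply: Lu; first by exists `|c|.
  by under eq_fun do rewrite dyadic_mean_cst; exact: cvg_cst.
- move=> f j m bf; have [M hM] := bf; apply: Lu.
    by exists M => t t0; apply: hM; rewrite addr_ge0.
  have M0 : 0 <= M by apply: le_trans (hM 0 _); rewrite ?normr_ge0.
  have small : dyadic_mean n (fun t => f (t + j%:R / 2 ^+ m)) - dyadic_mean n f @[n --> G]
      --> (0 : R).
    apply: cvg_trans; first exact: (cvg_app _ sG).
    apply/cvg_distP0.
    have hc : 2 * M * j%:R * (1 / 2) ^+ n @[n --> \oo] --> (0 : R).
      rewrite -(mulr0 (2 * M * j%:R)); apply: cvgMr; apply: cvg_expr.
      by rewrite ger0_norm //; lra.
    apply: squeeze0 hc; near=> n; rewrite normr_ge0 subr0 /=.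
    have mn : (m <= n)%N by near: n; exists m.
    (* On the grid of mesh $2^{-n}$ with $n\ge m$ the shift is $j2^{n-m}$ nodes. *)
    have -> : j%:R / 2 ^+ m = (j * 2 ^ (n - m))%:R / 2 ^+ n :> R.
      rewrite natrM natrX -{2}(subnK mn) exprD; field.
      by rewrite !expf_neq0 ?pnatr_eq0.
    apply: le_trans (dyadic_mean_shift _ _ hM) _.
    have -> : (4 ^ n)%:R = 2 ^+ n * 2 ^+ n :> R.
      by rewrite -exprMn natrX; congr (_ ^+ _); rewrite -natrM.
    have p0 : 0 < (2 : R) ^+ n by rewrite exprn_gt0.
    rewrite natrM natrX expr_div_n expr1n.
    have -> : (2 ^+ n * 2 ^+ n)^-1 * (2 * M * (j%:R * 2 ^+ (n - m))) =
        (2 * M * j%:R * (1 / 2 ^+ n)) * (2 ^+ (n - m) / 2 ^+ n) :> R.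
      by field; rewrite gt_eqF.
    rewrite ler_piMr ?mulr_ge0 ?divr_ge0 ?exprn_ge0 // ler_pdivrMr // mul1r.
    by rewrite ler_weXn2l ?ler1n // leq_subr.
  have -> : (fun n => dyadic_mean n (fun t => f (t + j%:R / 2 ^+ m))) = fun n =>
      dyadic_mean n (fun t => f (t + j%:R / 2 ^+ m)) - dyadic_mean n f + dyadic_mean n f.
    by apply/funext => n; rewrite subrK.
  by rewrite -[L f]add0r; apply: cvgD; [exact: small | exact: hL].
Unshelve. all: end_near.
Qed.

End InvariantMean.

(** * Integrals of almost everywhere Borel functions *)

Lemma le_lower_integral d (T : measurableType d) (R : realType)
    (mu : {measure set T -> \bar R}) (D : set T) (f g : T -> \bar R) :
  (forall x, D x -> 0 <= f x)%E -> (forall x, D x -> f x <= g x)%E ->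
  (\int[mu]_(x in D) f x <= \int[mu]_(x in D) g x)%E.
Proof.
move=> f0 fg; have g0 x : D x -> (0 <= g x)%E by move=> Dx; rewrite (le_trans (f0 x Dx)) ?fg.
rewrite !ge0_integralE //; apply: le_ereal_sup => _ [h hf <-].
by exists h => // x; apply: le_trans (hf x) _; exact: lee_restrict.
Qed.

(* The integral of a non-negative function is a supremum over simple minorants, also when the function
   is not Borel, as may happen to [fun s => C (T s h)] on a null set. *)
Lemma lower_integral_ae d (T : measurableType d) (R : realType)
    (mu : {measure set T -> \bar R}) (D N : set T) (f g : T -> \bar R) :
  measurable D -> measurable N -> mu N = 0%E -> measurable_fun D g ->
  (forall x, D x -> 0 <= f x)%E -> (forall x, D x -> 0 <= g x)%E ->
  (forall x, D x -> ~ N x -> f x = g x) ->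
  (\int[mu]_(x in D) f x = \int[mu]_(x in D) g x)%E.
Proof.
move=> mD mN N0 mg f0 g0 fg.
(* Resetting [g] to a constant on [N] keeps its integral; the value [+oo] puts it above [f]
   everywhere, the value 0 below. *)
pose gi (c : \bar R) x := if x \in N then c else g x.
have mgi c : measurable_fun D (gi c).
  apply: measurable_fun_if => //.
    apply: (@measurable_fun_bool _ _ _ _ true) => //.
    rewrite (_ : _ @^-1` _ = N); last by apply/seteqP; split=> x /= => [/set_mem|/mem_set].
    exact: measurableI.
  by apply: (measurable_funS mD) => // x [].
have gigi c : (0 <= c)%E -> (\int[mu]_(x in D) gi c x = \int[mu]_(x in D) g x)%E.
  move=> c0; apply: ge0_ae_eq_integral => //.
    by move=> x Dx; rewrite /gi; case: ifP => // _; exact: g0.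
  exists N; split => // x /=; apply: contra_notP => nN _.
  by rewrite /gi memNset.
apply/eqP; rewrite eq_le; apply/andP; split.
  rewrite -(gigi +oo%E) //; apply: le_lower_integral => // x Dx; rewrite /gi.
  by case: ifPn => [_|/negP xN]; [exact: leey | rewrite fg // => /mem_set].
rewrite -(gigi 0%E) //; apply: le_lower_integral => x Dx; rewrite /gi.
  by case: ifP => // _; exact: g0.
by case: ifPn => [_|/negP xN]; [exact: f0 | rewrite fg // => /mem_set].
Qed.

Section Lebesgue.
Variable R : realType.
Local Notation mu := (@lebesgue_measure R).

Lemma measurable_shift (r : R) :
  measurable_fun [set: measurableTypeR R] (fun s : measurableTypeR R => s + r : measurableTypeR R).
Proof. by apply: measurable_funD; [exact: measurable_id | exact: measurable_cst]. Qed.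

Definition shifted_lebesgue (r : R) : {measure set (measurableTypeR R) -> \bar R} :=
  measure_function_pushforward__canonical__measure_function_Measure mu (measurable_shift r).

Lemma lebesgue_shift (r : R) (A : set R) : measurable A -> shifted_lebesgue r A = mu A.
Proof.
move=> mA; apply/esym/(@lebesgue_measure_unique R (shifted_lebesgue r)) => //.
move=> X [[a b] _ <-] /=; rewrite /pushforward /=.
rewrite (_ : _ @^-1` _ = `]a - r, b - r]%classic).
  rewrite !lebesgue_measure_itv /= !lte_fin ltrD2r -!EFinB.
  by case: ifP => // _; congr EFin; ring.
by apply/seteqP; split=> x /=; rewrite !in_itv /= ltrBlDr lerBrDr.
Qed.

Lemma ge0_integral_shift (g : R -> \bar R) (r t : R) :
  measurable_fun `[r, (t + r)%R]%classic g -> (forall s, 0 <= g s)%E ->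
  (\int[mu]_(s in `[0%R, t]%classic) g (s + r)%R =
   \int[mu]_(s in `[r, (t + r)%R]%classic) g s)%E.
Proof.
move=> mg g0.
transitivity (\int[shifted_lebesgue r]_(s in `[r, (t + r)%R]%classic) g s)%E.
  rewrite (ge0_integral_pushforward (measurable_shift r)) //.
  rewrite (_ : _ @^-1` _ = `[0, t]%classic) //.
  by apply/seteqP; split=> x /=; rewrite !in_itv /= lerD2r -lerBlDr subrr.
apply: eq_measure_integral => A mA _; exact: lebesgue_shift.
Qed.

Lemma integral_shift (g : R -> \bar R) (r t : R) :
  measurable_fun `[r, (t + r)%R]%classic g ->
  (\int[mu]_(s in `[0%R, t]%classic) g (s + r)%R =
   \int[mu]_(s in `[r, (t + r)%R]%classic) g s)%E.
Proof.
move=> mg; rewrite integralE [RHS]integralE; congr (_ - _)%E.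
- rewrite -(ge0_integral_shift (g := g^\+%E)) //; last exact: measurable_funepos.
  by apply: eq_integral => s _; rewrite !funeposE.
- rewrite -(ge0_integral_shift (g := g^\-%E)) //; last exact: measurable_funeneg.
  by apply: eq_integral => s _; rewrite !funenegE.
Qed.

(** Only the squared norm is made Borel. Off the null set it is the limit of the squared norms of
    the simple functions, which take finitely many values on measurable pieces; elsewhere [g] is
    0. *)
Lemma bochner_repr (W : normedModType R[i]) (f : R -> W) :
  bochner_measurable `[0, +oo[ f -> exists (g : R -> R) (N : set R),
    [/\ measurable_fun setT g, forall s, 0 <= g s, measurable N, mu N = 0%E
      & forall s, 0 <= s -> ~ N s -> nrm (f s) ^+ 2 = g s].
Proof.
case=> u [su [N [mN N0 hN]]].
pose A := `[0%R, +oo[%classic `\` N.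
have mA : measurable A by exact: measurableD.
pose q s := nrm (f s) ^+ 2.
have mq : measurable_fun [set: R] (q \_ A).
  apply: (measurable_restrictT q mA).1.
  apply: (measurable_fun_cvg (h := fun n s => nrm (u n s) ^+ 2)).
    move=> n _ Y mY; have [fin ms] := su n.
    rewrite (_ : _ `&` _ = A `&` \bigcup_(y in [set y | (u n @` `[0, +oo[) y /\ Y (nrm y ^+ 2)])
        (`[0, +oo[ `&` u n @^-1` [set y])); last first.
      apply/seteqP; split=> x /=.
        by move=> [Ax Yx]; split => //; exists (u n x); split => //; [exists x => //|]; case: Ax.
      by move=> [Ax [y [_ Yy] [_ uy]]]; split => //; rewrite uy.
    apply: measurableI => //; apply: fin_bigcup_measurable => //.
    by apply: sub_finite_set fin => y [].
  move=> s [s0 nNs].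
  have /cvg_nrm us : u n s @[n --> \oo] --> f s.
    by apply: contrapT => h; apply: nNs; apply: hN => /=; apply/not_implyP.
  by rewrite /q expr2; under eq_fun do rewrite expr2; exact: cvgM.
exists (q \_ A), N; split => //.
- by move=> s; rewrite patchE; case: ifP => // _; exact: sqr_ge0.
- move=> s s0 nNs; rewrite patchE mem_set //; split => //=.
  by rewrite in_itv /= s0.
Qed.

(* Up to a null set, [q] is an integrable Borel function on [0, t], of integral [G]. *)
Definition IntR (t : R) (q : R -> R) (G : R) :=
  exists (g : R -> R) (N : set R), [/\ mu.-integrable `[0, t] (EFin \o g),
    measurable N, mu N = 0%E, forall s, 0 <= s <= t -> ~ N s -> q s = g s
    & G = \int[mu]_(s in `[0, t]) g s].

Lemma IntR_ext t q q' G : (forall s, 0 <= s -> q s = q' s) -> IntR t q G -> IntR t q' G.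
Proof.
move=> qq' [g [N [ig mN N0 qg ->]]]; exists g, N; split => // s /andP[s0 st] nN.
by rewrite -qq' // qg // s0.
Qed.

(** This carries the additivity of the energies: an identity between integrals follows once the
    integrands agree pointwise and both sides satisfy [IntR]. *)
Lemma IntR_unique t q G G' : IntR t q G -> IntR t q G' -> G = G'.
Proof.
move=> [g [N [ig mN N0 qg ->]]] [g' [N' [ig' mN' N0' qg' ->]]]; congr fine.
apply: ae_eq_integral => //; first exact: measurable_int ig.
  exact: measurable_int ig'.
exists (N `|` N'); split; [exact: measurableU | by rewrite measureU0 |].
move=> s /=; apply: contra_notP => /not_orP[nN nN'].
by rewrite in_itv /= => st; rewrite -qg // -qg'.
Qed.

Lemma IntRD t q q' G G' :
  IntR t q G -> IntR t q' G' -> IntR t (fun s => q s + q' s) (G + G').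
Proof.
move=> [g [N [ig mN N0 qg ->]]] [g' [N' [ig' mN' N0' qg' ->]]].
exists (fun s => g s + g' s), (N `|` N'); split.
- by apply: integrableD ig ig'.
- exact: measurableU.
- by rewrite measureU0.
- by move=> s st /not_orP[nN nN']; rewrite qg // qg'.
- by rewrite RintegralD.
Qed.

Lemma IntRZ t a q G : IntR t q G -> IntR t (fun s => a * q s) (a * G).
Proof.
move=> [g [N [ig mN N0 qg ->]]]; exists (fun s => a * g s), N; split => //.
- by apply: integrableZl ig.
- by move=> s st nN; rewrite qg.
- by rewrite RintegralZl.
Qed.

Lemma IntR_nneg t (q : R -> R) (g : R -> R) (N : set R) :
  measurable_fun [set: R] g -> (forall s, 0 <= g s) -> measurable N -> mu N = 0%E ->
  (forall s, 0 <= q s) -> (forall s, 0 <= s -> ~ N s -> q s = g s) ->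
  (\int[mu]_(s in `[0%R, t]%classic) (q s)%:E < +oo)%E ->
  IntR t q (fine (\int[mu]_(s in `[0%R, t]%classic) (q s)%:E)).
Proof.
move=> mg g0 mN N0 q0 qg fin.
have mgt : measurable_fun `[0, t]%classic (EFin \o g).
  by apply/measurable_EFinP; apply: (measurable_funS measurableT).
have E : (\int[mu]_(s in `[0%R, t]%classic) (q s)%:E =
    \int[mu]_(s in `[0%R, t]%classic) (g s)%:E)%E.
  apply: (@lower_integral_ae _ (measurableTypeR R) R mu _ N) => //.
  - by move=> s _; rewrite lee_fin.
  - by move=> s _; rewrite lee_fin.
  - by move=> s /=; rewrite in_itv /= => /andP[s0 _] nN; rewrite qg.
exists g, N; split => //; last by rewrite E.
- apply/integrableP; split => //; move: fin; rewrite E.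
  by under eq_integral do rewrite -(ger0_norm (g0 _)).
- by move=> s /andP[s0 _]; exact: qg.
Qed.

(** Translation takes $[0,t]$ to $[r,t+r]\subseteq[0,t+r]$. The exceptional null set is translated
    as well and stays null. *)
Lemma integral_shift_le (q : R -> R) (g : R -> R) (N : set R) (r t : R) : 0 <= r ->
  measurable_fun [set: R] g -> (forall s, 0 <= g s) -> measurable N -> mu N = 0%E ->
  (forall s, 0 <= q s) -> (forall s, 0 <= s -> ~ N s -> q s = g s) ->
  (\int[mu]_(s in `[0%R, t]%classic) (q (s + r))%:E <=
   \int[mu]_(s in `[0%R, (t + r)%R]%classic) (q s)%:E)%E.
Proof.
move=> r0 mg g0 mN N0 q0 qg.
have mgD (D : set R) : measurable D -> measurable_fun D (EFin \o g).
  by move=> mD; apply/measurable_EFinP; apply: (measurable_funS measurableT).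
have mS : measurable ((fun s => s + r) @^-1` N).
  by rewrite -[X in measurable X]setTI; exact: measurable_shift.
rewrite (@lower_integral_ae _ (measurableTypeR R) R mu _ ((fun s => s + r) @^-1` N)
  _ (fun s => (g (s + r))%:E)) //.
- have g0' s : (0 <= (EFin \o g) s)%E by rewrite lee_fin.
  rewrite (ge0_integral_shift (mgD _ (measurable_itv _)) g0').
  rewrite [leRHS](@lower_integral_ae _ (measurableTypeR R) R mu _ N _ (fun s => (g s)%:E)) //.
  + apply: ge0_subset_integral => //; first exact: mgD.
    by move=> s /=; rewrite !in_itv /= => /andP[rs ->]; rewrite (le_trans r0).
  + exact: mgD.
  + by move=> s _; rewrite lee_fin.
  + by move=> s _; rewrite lee_fin.
  + by move=> s /=; rewrite in_itv /= => /andP[s0 _] nN; rewrite qg.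
- by rewrite -[LHS]/(shifted_lebesgue r N) lebesgue_shift.
- apply/measurable_EFinP; apply: measurable_funS (measurableT) _ _ => //.
  apply: (measurableT_comp (f := g)) => //; exact: measurable_shift.
- by move=> s _; rewrite lee_fin.
- by move=> s _; rewrite lee_fin.
- by move=> s /=; rewrite in_itv /= => /andP[s0 _] nN; rewrite qg // addr_ge0.
Qed.

End Lebesgue.

(** * From admissible operators to contractions *)

Lemma cvg_within_nneg (R : realType) (V : normedModType R[i]) (f : R -> V)
    (T : Type) (F : set_system T) {FF : Filter F} (u : T -> R) (t : R) :
  {within `[0, +oo[, continuous f} -> 0 <= t -> (\forall x \near F, 0 <= u x) ->
  u @ F --> t -> f (u x) @[x --> F] --> f t.
Proof.
move=> /subspace_continuousP cf t0 u0 ut A /(cf t) h.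
have /ut hF : within `[0, +oo[ (nbhs t) (f @^-1` A) by apply: h; rewrite /= in_itv /= t0.
apply: filterS2 u0 hF => x ux; apply.
by rewrite /= in_itv /= andbT.
Qed.

Lemma dyadic_floor_cvg (R : realType) (t : R) : 0 <= t ->
  (Num.truncn (t * 2 ^+ n))%:R / 2 ^+ n @[n --> \oo] --> t.
Proof.
move=> t0; apply/cvg_distP0.
have hc : (1 / 2) ^+ n @[n --> \oo] --> (0 : R).
  by apply: cvg_expr; rewrite ger0_norm //; lra.
apply: squeeze0 hc; apply: nearW => n; rewrite normr_ge0 /=.
have p0 : 0 < (2 : R) ^+ n by rewrite exprn_gt0.
have := @truncn_itv R (t * 2 ^+ n); rewrite mulr_ge0 ?(ltW p0) // => /(_ isT).
rewrite -[_.+1]addn1 natrD => /andP[h1 h2].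
have -> : (Num.truncn (t * 2 ^+ n))%:R / 2 ^+ n - t =
    ((Num.truncn (t * 2 ^+ n))%:R - t * 2 ^+ n) / 2 ^+ n by field; rewrite gt_eqF.
rewrite normrM [`|_^-1|]ger0_norm ?invr_ge0 ?(ltW p0) // expr_div_n expr1n.
rewrite ler_pM2r ?invr_gt0 // ler_norml; move: h1 h2.
move: ((Num.truncn (t * 2 ^+ n))%:R : R) (t * 2 ^+ n) => w z h1 h2.
by apply/andP; split; lra.
Qed.

Section AdmissibleSimilar.
Variables (R : realType) (H : completeNormedModType R[i]) (T : R -> H -> H).
Variables (K : completeNormedModType R[i]) (D : set H) (C : H -> K).
Variables (r : H -> H -> R) (rK : K -> K -> R).
Hypotheses (hr : is_rip r) (hrK : is_rip rK) (hT : C0_semigroup T).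
Hypotheses (sD : Defs.subspace D) (dD : dense D) (linC : linear_on D C).
Hypotheses (TD : forall t, 0 <= t -> forall h, D h -> D (T t h)).
Hypothesis mC : forall h, D h -> bochner_measurable `[0, +oo[ (fun t => C (T t h)).
Variables al be : R.
Hypotheses (al0 : 0 < al) (albe : al <= be).
Local Notation mu := (@lebesgue_measure R).
Hypothesis energy : forall h t, D h -> 0 <= t ->
  ((al * nrm h ^+ 2)%:E <= (nrm (T t h) ^+ 2)%:E
     + \int[mu]_(s in `[0%R, t]%classic) ((nrm (C (T s h)) ^+ 2)%:E)
   <= (be * nrm h ^+ 2)%:E)%E.

Let linT t : 0 <= t -> linear_op (T t).
Proof. by move=> t0; case: hT => h _ _ _; case: (h _ t0). Qed.

Let CZ a x : D x -> C (a *: x) = a *: C x.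
Proof.
have C0 : C 0 = 0.
  have /eqP := linC 1 (sub0 sD) (sub0 sD); rewrite !scale1r addr0.
  by rewrite -subr_eq0 opprD addNKr oppr_eq0 => /eqP.
by move=> Dx; rewrite -[a *: x]addr0 linC ?C0 ?addr0 //; exact: sub0.
Qed.

Let CD x y : D x -> D y -> C (x + y) = C x + C y.
Proof. by move=> Dx Dy; rewrite -[x in LHS]scale1r linC // scale1r. Qed.

Let CB x y : D x -> D y -> C (x - y) = C x - C y.
Proof. move=> Dx Dy; have DN := subN sD Dy; by rewrite CD // -[- y]scaleN1r CZ // scaleN1r. Qed.

Let q h s := nrm (C (T s h)) ^+ 2.
Let I t h := fine (\int[mu]_(s in `[0%R, t]%classic) (q h s)%:E)%E.
(** Polarisation of [I], standing for $\operatorname{Re}\int_0^t\langle CT(s)x,CT(s)y\rangle\,ds$.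
    It is written with integrals of squares, which the energy bound makes finite. *)
Let J t x y := 4^-1 * (I t (x + y) + -1 * I t (x - y)).

Let int_fin h t : D h -> 0 <= t -> (\int[mu]_(s in `[0%R, t]%classic) (q h s)%:E < +oo)%E.
Proof.
move=> Dh t0; have /andP[_ le] := energy Dh t0; apply: contraLR le.
by rewrite -leNgt leye_eq => /eqP; rewrite /q => ->; rewrite -ltNge addey // ltry.
Qed.

Let int_num h t : D h -> 0 <= t ->
  (\int[mu]_(s in `[0%R, t]%classic) (q h s)%:E)%E \is a fin_num.
Proof.
move=> Dh t0; rewrite ge0_fin_numE ?int_fin // integral_ge0 // => s _.
by rewrite lee_fin sqr_ge0.
Qed.

Let IntR_q h t : D h -> 0 <= t -> IntR t (q h) (I t h).
Proof.
move=> Dh t0; have [g [N [mg g0 mN N0 qg]]] := bochner_repr (mC Dh).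
by apply: (IntR_nneg mg g0 mN N0) => // [s|]; [exact: sqr_ge0 | exact: int_fin].
Qed.

Let IntR_J x y t : D x -> D y -> 0 <= t ->
  IntR t (fun s => rK (C (T s x)) (C (T s y))) (J t x y).
Proof.
move=> Dx Dy t0.
have h := IntRZ 4^-1 (IntRD (IntR_q (subD sD Dx Dy) t0) (IntRZ (-1) (IntR_q (subB sD Dx Dy) t0))).
apply: IntR_ext h => s s0; rewrite /q.
have Tx := TD s0 Dx; have Ty := TD s0 Dy.
rewrite (lopD (linT s0)) (lopB (linT s0)) CD // CB //.
by rewrite (rip_sqrD hrK) (rip_sqrB hrK); field.
Qed.

Let J_hform t : 0 <= t -> hform D (J t).
Proof.
move=> t0; have [kD kC kJ kZ] := hrK.1; split.
- move=> x y z Dx Dy Dz; apply: (IntR_unique (IntR_J (subD sD Dx Dy) Dz t0)).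
  apply: IntR_ext (IntRD (IntR_J Dx Dz t0) (IntR_J Dy Dz t0)) => s s0.
  by rewrite (lopD (linT s0)) CD ?kD //; exact: TD.
- move=> x y Dx Dy; apply: (IntR_unique (IntR_J Dx Dy t0)).
  by apply: IntR_ext (IntR_J Dy Dx t0) => s s0; exact: kC.
- move=> a x y Dx Dy; have DZ := subZ sD a^* Dy; have DZ' := subZ sD a Dx.
  apply: (IntR_unique (IntR_J DZ' Dy t0)).
  apply: IntR_ext (IntR_J Dx DZ t0) => s s0.
  by rewrite !(lopZ (linT s0)) !CZ ?kJ //; exact: TD.
- move=> a x y Dx Dy; have DZ' := subZ sD (rC a) Dx.
  apply: (IntR_unique (IntR_J DZ' Dy t0)).
  apply: IntR_ext (IntRZ a (IntR_J Dx Dy t0)) => s s0.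
  by rewrite (lopZ (linT s0)) CZ ?kZ //; exact: TD.
Qed.

Let JE t x : D x -> 0 <= t -> J t x x = I t x.
Proof.
move=> Dx t0; apply: (IntR_unique (IntR_J Dx Dx t0)).
by apply: IntR_ext (IntR_q Dx t0) => s s0; rewrite (ripE hrK).
Qed.

Let b t x y := r (T t x) (T t y) + J t x y.

Let b_hform t : 0 <= t -> hform D (b t).
Proof.
move=> t0; have [jD jC jJ jZ] := J_hform t0.
have [tD tC tJ tZ] := hform_lop D (linT t0) hr.
split=> *; rewrite /b.
- by rewrite jD // tD //; ring.
- by rewrite jC // tC.
- by rewrite jJ // tJ.
- by rewrite jZ // tZ //; ring.
Qed.

Let bE t x : D x -> 0 <= t -> b t x x = nrm (T t x) ^+ 2 + I t x.
Proof. by move=> Dx t0; rewrite /b JE // (ripE hr). Qed.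

Let b_itv t x : D x -> 0 <= t -> al * nrm x ^+ 2 <= b t x x <= be * nrm x ^+ 2.
Proof. by move=> Dx t0; rewrite bE // -!lee_fin EFinD fineK ?int_num //; exact: energy. Qed.

Let be0 : 0 < be. Proof. exact: lt_le_trans albe. Qed.

Let b_bnd x y : D x -> D y -> bounded_nneg (fun t => b t x y).
Proof.
move=> Dx Dy; exists (be * nrm x * nrm y) => t t0.
apply: (hform_bound sD (b_hform t0)) => //; first exact: ltW.
move=> z Dz; have /andP[h ->] := b_itv Dz t0; rewrite andbT.
by apply: le_trans h; rewrite mulr_ge0 ?sqr_ge0 ?ltW.
Qed.

(** The terms outside the integrals agree by the semigroup law, and the shifted integral misses only
    the part over $[0,s]$. *)
Let b_shift t s h : D h -> 0 <= t -> 0 <= s -> b t (T s h) (T s h) <= b (t + s) h h.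
Proof.
move=> Dh t0 s0; have DT := TD s0 Dh; have ts0 := addr_ge0 t0 s0.
rewrite !bE //; have [_ _ hadd _] := hT; rewrite hadd // lerD2l.
rewrite fine_le ?int_num //.
have [g [N [mg g0 mN N0 qg]]] := bochner_repr (mC Dh).
have := @integral_shift_le _ (q h) g N s t s0 mg g0 mN N0 (fun=> sqr_ge0 _) qg.
apply: le_trans; rewrite le_eqVlt; apply/orP; left; apply/eqP.
apply: eq_integral => w; rewrite inE /= in_itv /= => /andP[w0 _].
by rewrite /q hadd.
Qed.

Lemma admissible_similar : similar_to_contraction T.
Proof.
have [L [LD LZ Lle Lc Lshift]] := invariant_mean R.
(* [L] takes functions on all of [R], while the form identities hold for [t >= 0] only. *)
have Lext f g : bounded_nneg f -> (forall t, 0 <= t -> f t = g t) -> L f = L g.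
  move=> bf fg; have bg : bounded_nneg g.
    by have [M hM] := bf; exists M => t t0; rewrite -fg // hM.
  by apply/eqP; rewrite eq_le !Lle // => t t0; rewrite fg.
pose bL x y := L (fun t => b t x y).
have bLh : hform D bL.
  split=> [x y z|x y|a x y|a x y] Dx Dy *; rewrite /bL.
  - rewrite -LD; [|exact: b_bnd|exact: b_bnd]; apply: Lext.
      by apply: b_bnd => //; exact: subD.
    by move=> t t0; rewrite (hformDl (b_hform t0)).
  - by apply: Lext => [|t t0]; [exact: b_bnd | rewrite (hformC (b_hform t0))].
  - apply: Lext => [|t t0]; last by rewrite (hformJ (b_hform t0)).
    by apply: b_bnd => //; exact: subZ.
  - rewrite -LZ; last exact: b_bnd.
    apply: Lext => [|t t0]; last by rewrite (hformZl (b_hform t0)).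
    by apply: b_bnd => //; exact: subZ.
have bLi x : D x -> al * nrm x ^+ 2 <= bL x x <= be * nrm x ^+ 2.
  move=> Dx; have bc c : @bounded_nneg R (fun=> c) by exists `|c|.
  rewrite -{1}(Lc (al * _)) -(Lc (be * _)); apply/andP.
  by split; apply: Lle; do ?[exact: b_bnd] => // t t0; have /andP[] := b_itv Dx t0.
have [S [bS Sb /(_ al0)[S' [bS' SK S'K]]]] := form_root hr sD dD bLh (ltW al0) albe be0 bLi.
have /bounded_op_nrm[linS [M M0 SM]] := bS.
(* With $s=j/2^m$, averaging $b_t(T(s)h,T(s)h)\le b_{t+s}(h,h)$ over $t$ and using invariance under
   this dyadic shift gives the contraction on [D]. *)
have dyadic h (j m : nat) : D h -> nrm (S (T (j%:R / 2 ^+ m) h)) <= nrm (S h).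
  move=> Dh; have s0 : 0 <= j%:R / 2 ^+ m :> R by rewrite divr_ge0 ?exprn_ge0.
  have DT := TD s0 Dh.
  rewrite -(@ler_pXn2r _ 2) ?nnegrE ?nrm_ge0 // !Sb // /bL.
  rewrite -[leRHS](Lshift _ j m); last exact: b_bnd.
  apply: Lle; [exact: b_bnd | | by move=> t t0; exact: b_shift].
  by have [N hN] := b_bnd Dh Dh; exists N => t t0; apply: hN; exact: addr_ge0.
have real h t : D h -> 0 <= t -> nrm (S (T t h)) <= nrm (S h).
  move=> Dh t0; pose u n : R := (Num.truncn (t * 2 ^+ n))%:R / 2 ^+ n.
  have u0 n : 0 <= u n by rewrite divr_ge0 ?exprn_ge0.
  have ut : u n @[n --> \oo] --> t by exact: dyadic_floor_cvg.
  have [_ _ _ /(_ h) cT] := hT.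
  have Tu : T (u n) h @[n --> \oo] --> T t h.
    by apply: (cvg_within_nneg cT t0 _ ut); apply: nearW.
  have nSu : nrm (S (T (u n) h)) @[n --> \oo] --> nrm (S (T t h)).
    by apply: cvg_nrm; apply: (lop_cvg linS SM Tu).
  by apply: (cvgr_to_le nSu); apply: nearW => n; exact: dyadic.
exists S, S'; split => // t t0 x; rewrite -{2}(S'K x); move: (S' x) => {}x.
have [hb _ _ _] := hT; have /bounded_op_nrm[_ [M' M'0 TM]] := hb t t0.
(* From [D] to [H]: replacing [x] by a [d] in [D] closer than [e] costs [M * M' * e] for [S (T t x)]
   and [M * e] for [S x]. *)
apply: (@ler_eps _ _ _ (M * M' + M)) => e e0.
have [d Dd xd] := dense_approx dD x e0.
have -> : x = d + (x - d) by rewrite addrC subrK.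
rewrite (lopD (linT t0)) (lopD linS) (le_trans (ler_nrmD _ _)) //.
have h1 := real d t Dd t0.
have h2 : nrm (S (T t (x - d))) <= M * M' * e.
  rewrite (le_trans (SM _)) // -mulrA ler_wpM2l // (le_trans (TM _)) //.
  by rewrite ler_wpM2l // ltW.
have h3 : nrm (S d) <= nrm (S (d + (x - d))) + M * e.
  have -> : S d = S (d + (x - d)) - S (x - d) by rewrite -(lopB linS) addrK.
  rewrite (le_trans (ler_nrmB _ _)) // lerD2l (le_trans (SM _)) //.
  by rewrite ler_wpM2l // ltW.
by lra.
Qed.

End AdmissibleSimilar.

(** * Generators of semigroups *)

Section RealIntegral.
Variable R : realType.
Local Notation mu := (@lebesgue_measure R).
Implicit Types g : R -> R.

Lemma integrable_within_nneg g (a b : R) : 0 <= a ->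
  {within `[0, +oo[, continuous g} -> mu.-integrable `[a, b] (EFin \o g).
Proof.
move=> a0 cg; apply: continuous_compact_integrable; first exact: segment_compact.
apply: continuous_subspaceW cg => s /=; rewrite !in_itv /= => /andP[+ _].
by rewrite andbT; exact: le_trans.
Qed.

Lemma Rintegral_split_shift g (t h : R) : 0 <= t -> 0 <= h ->
  {within `[0, +oo[, continuous g} ->
  \int[mu]_(s in `[0, t + h]) g s = \int[mu]_(s in `[0, t]) g s + \int[mu]_(s in `[0, h]) g (s + t).
Proof.
move=> t0 h0 cg; have ig a b : 0 <= a -> mu.-integrable `[a, b] (EFin \o g).
  by move=> a0; exact: integrable_within_nneg.
have ith : mu.-integrable `]t, t + h] (EFin \o g).
  apply: integrableS (ig t (t + h) t0) => //; exact: subset_itv_oc_cc.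
rewrite -[LHS](subrK (\int[mu]_(s in `[0, t]) g s)) addrC; congr (_ + _).
rewrite (Rintegral_itvB (x := t)) ?bnd_simp ?lerDl //; last exact: ig.
rewrite Rintegral_itv_obnd_cbnd // /Rintegral; congr fine.
rewrite (integral_shift (g := EFin \o g) (t := h)) [h + t]addrC //.
by have /integrableP[] := ig t (t + h) t0.
Qed.

Lemma Rintegral_const (t c : R) : 0 <= t -> \int[mu]_(s in `[0, t]) c = t * c.
Proof.
move=> t0; have E : mu `[0, t]%classic = t%:E.
  rewrite lebesgue_measure_itv /= lte_fin sube0.
  by case: ltP => // h; congr EFin; apply/eqP; rewrite eq_le t0.
transitivity (c * fine (mu `[0, t]%classic)); last by rewrite E mulrC.
exact: Rintegral_cst.
Qed.

Lemma Rintegral_bound g (t M : R) : 0 <= t -> {within `[0, +oo[, continuous g} ->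
  (forall s, 0 <= s <= t -> `|g s| <= M) -> `|\int[mu]_(s in `[0, t]) g s| <= t * M.
Proof.
move=> t0 cg gM; have ig : mu.-integrable `[0, t] (EFin \o g) by exact: integrable_within_nneg.
rewrite (le_trans (le_normr_Rintegral _ ig)) //.
rewrite -Rintegral_const //.
apply: le_Rintegral => //.
- by have := integrable_norm ig.
- apply: integrable_within_nneg => //; apply: continuous_subspaceT => s; exact: cvg_cst.
Qed.

End RealIntegral.

(** * Weak integrals of orbits and the generator of a bounded semigroup *)

Section Semigroup.
Variables (R : realType) (H : completeNormedModType R[i]) (r : H -> H -> R).
Hypothesis hr : is_rip r.
Variable U : R -> H -> H.
Hypothesis hU : C0_semigroup U.
Variable B : R.
Hypotheses (B0 : 0 <= B) (UB : forall t x, 0 <= t -> nrm (U t x) <= B * nrm x).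
Local Notation mu := (@lebesgue_measure R).
Let hrT : hform setT r := hr.1.
Let sT := @subspaceT R H.

Lemma semigroup_linear t : 0 <= t -> linear_op (U t).
Proof. by move=> t0; case: hU => h _ _ _; case: (h _ t0). Qed.

Lemma semigroup_add s t x : 0 <= s -> 0 <= t -> U (s + t) x = U s (U t x).
Proof. by move=> s0 t0; case: hU => _ _ h _; exact: h. Qed.

Lemma semigroup_comm s t x : 0 <= s -> 0 <= t -> U s (U t x) = U t (U s x).
Proof. by move=> s0 t0; rewrite -!semigroup_add // addrC. Qed.

Lemma semigroup_cvg0 x : U t x @[t --> 0^'+] --> x.
Proof.
have [_ U0 _ /(_ x) cU] := hU; rewrite -{2}(U0 x).
apply: (cvg_within_nneg cU) => //; last exact: cvg_at_right_filter.
by near=> t; apply: ltW; near: t; exact: nbhs_right_gt.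
Unshelve. all: end_near.
Qed.

Let orbit_continuous x z : {within `[0, +oo[, continuous (fun s => r (U s x) z)}.
Proof.
have [_ _ _ /(_ x)/subspace_continuousP cU] := hU.
by apply/subspace_continuousP => s s0; exact: (cvg_ripl hr (cU s s0)).
Qed.

Lemma semigroup_integral_ex t x : 0 <= t ->
  exists w, forall z, r w z = \int[mu]_(s in `[0, t]) r (U s x) z.
Proof.
move=> t0.
have [|||w hw] := @riesz _ _ r hr setT sT
    (fun z => \int[mu]_(s in `[0, t]) r (U s x) z) (t * (B * nrm x)).
- move=> y z _ _; rewrite -RintegralD //; try exact: integrable_within_nneg.
  by apply: eq_Rintegral => s _; rewrite (hformDr sT hrT).
- move=> a y _; rewrite -RintegralZl //; last exact: integrable_within_nneg.
  by apply: eq_Rintegral => s _; rewrite (hformZr sT hrT).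
- move=> z _; rewrite -mulrA; apply: Rintegral_bound => // s /andP[s0 _].
  by rewrite (le_trans (rip_CS _ _ hr)) // ler_wpM2r ?nrm_ge0 ?UB.
- by exists w => z; rewrite hw.
Qed.

(** The vector integral $\int_0^t U(s)x\,ds$ in the weak sense: it is fixed by its pairings, so
    scalar integrals and the Riesz theorem suffice. *)
Definition semigroup_integral t x : H :=
  xget 0 [set w | forall z, r w z = \int[mu]_(s in `[0, t]) r (U s x) z].
Local Notation W := semigroup_integral.

Lemma semigroup_integralE t x z : 0 <= t ->
  r (W t x) z = \int[mu]_(s in `[0, t]) r (U s x) z.
Proof.
move=> t0; rewrite /W; case: xgetP => [w -> ->//|h].
by have [w hw] := semigroup_integral_ex x t0; case: (h w).
Qed.

Lemma semigroup_integral_split t h x : 0 <= t -> 0 <= h ->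
  W (t + h) x = W t x + W h (U t x).
Proof.
move=> t0 h0; apply: (rip_ext hr) => z; have th0 := addr_ge0 t0 h0.
rewrite (hformDl hrT) // !semigroup_integralE // Rintegral_split_shift //.
congr (_ + _); apply: eq_Rintegral => s; rewrite inE /= in_itv /= => /andP[s0 _].
by rewrite semigroup_add.
Qed.

Lemma semigroup_integral_op t h x : 0 <= t -> 0 <= h -> U h (W t x) = W t (U h x).
Proof.
move=> t0 h0; apply: (rip_ext hr) => z.
have linU := semigroup_linear h0.
(* [z'] is the adjoint of [U h] applied to [z]; it carries [U h] through the weak integral. *)
have [|||z' hz'] := @riesz _ _ r hr setT sT (fun y => r (U h y) z) (B * nrm z).
- by move=> y y' _ _; rewrite (lopD linU) (hformDl hrT).
- by move=> a y _; rewrite (lopZ linU) (hformZl hrT).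
- move=> y _; rewrite (le_trans (rip_CS _ _ hr)) // mulrAC.
  by rewrite ler_wpM2r ?nrm_ge0 ?UB.
rewrite hz' // (hformC hrT) // !semigroup_integralE //.
apply: eq_Rintegral => s; rewrite inE /= in_itv /= => /andP[s0 _].
by rewrite semigroup_comm // hz' // (hformC hrT).
Qed.

Lemma semigroup_integral_cvg x : rC t^-1 *: W t x @[t --> 0^'+] --> x.
Proof.
apply/cvg_nrmP/cvgrPdist_le => e e0.
have /cvg_nrmP/cvgrPdist_le/(_ _ e0) : U t x @[t --> 0^'+] --> x.
  exact: semigroup_cvg0.
case=> d /= d0 hd; near=> t.
have t0 : 0 < t by near: t; exact: nbhs_right_gt.
have td : t < d by near: t; exact: nbhs_right_lt.
rewrite sub0r normrN ger0_norm ?nrm_ge0 //.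
have -> : rC t^-1 *: W t x - x = rC t^-1 *: (W t x - rC t *: x).
  by rewrite scalerBr scalerA -rCM mulVf ?gt_eqF // /rC rmorph1 scale1r.
rewrite nrmZ gtr0_norm ?invr_gt0 // mulrC ler_pdivrMr //.
(* Testing the weak integral against the error [v] itself upgrades weak control to norm control. *)
set v := _ - _; have [->|v0] := eqVneq (nrm v) 0; first by rewrite mulr_ge0 ?ltW.
have {}v0 : 0 < nrm v by rewrite lt_def v0 nrm_ge0.
rewrite -(ler_pM2r v0) -expr2 -(ripE hr) {1}/v (hformBl sT hrT) // (hformZl hrT) //.
rewrite semigroup_integralE ?(ltW t0) //.
rewrite -(Rintegral_const _ (ltW t0)).
have ic : {within `[0, +oo[, continuous (fun _ : R => r x v)}.
  by apply: continuous_subspaceT => s; exact: cvg_cst.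
have <- : \int[mu]_(s in `[0, t]) (r (U s x) v - r x v) =
    \int[mu]_(s in `[0, t]) r (U s x) v - \int[mu]_(s in `[0, t]) r x v.
  by rewrite RintegralB //; exact: integrable_within_nneg.
apply: le_trans (ler_norm _) _; rewrite [e * t]mulrC -mulrA.
apply: Rintegral_bound; first exact: ltW.
  move=> s; apply: cvgB; [exact: orbit_continuous | exact: ic].
move=> s /andP[s0 st]; rewrite -(hformBl sT hrT) // (le_trans (rip_CS _ _ hr)) //.
rewrite ler_wpM2r ?nrm_ge0 //.
(* The right neighbourhood filter says nothing at [s = 0], where the difference vanishes. *)
have [->|s1] := eqVneq s 0.
  by have [_ -> _ _] := hU; rewrite subrr nrm0 ltW.
have {}s1 : 0 < s by rewrite lt_def s1.
have := hd s; rewrite /= sub0r normrN ger0_norm ?(ltW s1) // => /(_ (le_lt_trans st td) s1).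
by rewrite sub0r normrN ger0_norm ?nrm_ge0.
Unshelve. all: end_near.
Qed.

Lemma genP x y : diffq U x t @[t --> 0^'+] --> y -> gen_dom U x /\ gen U x = y.
Proof.
move=> h; split; first by exists y.
by apply: cvg_lim => //; exact: norm_hausdorff.
Qed.

Lemma gen_cvg x : gen_dom U x -> diffq U x t @[t --> 0^'+] --> gen U x.
Proof. by case=> y h; rewrite (genP h).2. Qed.

Lemma diffq_linear a x y t : 0 <= t -> diffq U (a *: x + y) t = a *: diffq U x t + diffq U y t.
Proof.
move=> t0; rewrite /diffq (semigroup_linear t0) opprD addrACA -scalerBr scalerDr.
by rewrite !scalerA mulrC.
Qed.

Lemma gen_linear a x y : gen_dom U x -> gen_dom U y ->
  gen_dom U (a *: x + y) /\ gen U (a *: x + y) = a *: gen U x + gen U y.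
Proof.
move=> /gen_cvg hx /gen_cvg hy; apply: genP.
have : a *: diffq U x t + diffq U y t @[t --> 0^'+] --> a *: gen U x + gen U y.
  by apply: cvgD hy; apply: cvgZr.
apply: cvg_trans; apply: near_eq_cvg; near=> t.
by rewrite diffq_linear //; apply: ltW; near: t; exact: nbhs_right_gt.
Unshelve. all: end_near.
Qed.

Lemma gen_dom_subspace : Defs.subspace (gen_dom U).
Proof.
split; last by move=> a x y Dx Dy; exact: (gen_linear a Dx Dy).1.
apply: (proj1 (@genP 0 0 _)).
have : (fun=> 0 : H) t @[t --> (0 : R)^'+] --> (0 : H) by exact: cvg_cst.
apply: cvg_trans; apply: near_eq_cvg; near=> t.
have t0 : 0 <= t by apply: ltW; near: t; exact: nbhs_right_gt.
by rewrite /diffq (lop0 (semigroup_linear t0)) subrr scaler0.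
Unshelve. all: end_near.
Qed.

Lemma gen_invariant s x : 0 <= s -> gen_dom U x ->
  gen_dom U (U s x) /\ gen U (U s x) = U s (gen U x).
Proof.
move=> s0 /gen_cvg hx; apply: genP; have linU := semigroup_linear s0.
have : U s (diffq U x t) @[t --> 0^'+] --> U s (gen U x).
  by apply: (lop_cvg linU _ hx) => y; exact: UB.
apply: cvg_trans; apply: near_eq_cvg; near=> t.
have t0 : 0 <= t by apply: ltW; near: t; exact: nbhs_right_gt.
by rewrite /diffq (lopZ linU) (lopB linU) semigroup_comm.
Unshelve. all: end_near.
Qed.

(** Splitting $[0,t+h]$ in two ways gives $W_hx+W_tU_hx=W_tx+W_hU_tx$, so the difference quotient of
    $W_tx$ is $h^{-1}(W_hU_tx-W_hx)$. *)
Lemma gen_integral t x : 0 <= t -> gen_dom U (W t x) /\ gen U (W t x) = U t x - x.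
Proof.
move=> t0; apply: genP.
have : rC h^-1 *: W h (U t x) - rC h^-1 *: W h x @[h --> 0^'+] --> U t x - x.
  by apply: cvgB; exact: semigroup_integral_cvg.
apply: cvg_trans; apply: near_eq_cvg; near=> h.
have h0 : 0 <= h by apply: ltW; near: h; exact: nbhs_right_gt.
rewrite -scalerBr /diffq; congr (_ *: _); apply/eqP.
rewrite semigroup_integral_op // subr_eq addrAC eq_sym subr_eq.
have E : W h x + W t (U h x) = W t x + W h (U t x).
  by rewrite -!semigroup_integral_split // addrC.
by rewrite [W h (U t x) + _]addrC -E addrC.
Unshelve. all: end_near.
Qed.

(** The averages $t^{-1}W_tx$ lie in the domain and tend to $x$. *)
Lemma gen_dom_dense : dense (gen_dom U).
Proof.
move=> O [x Ox] oO; have nO : nbhs x O by exact: open_nbhs_nbhs.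
have hO := semigroup_integral_cvg nO; near (0 : R)^'+ => t.
exists (rC t^-1 *: W t x); split; first by near: t.
apply: subZ gen_dom_subspace _ _ _; apply: (proj1 (gen_integral x _)).
by apply: ltW; near: t; exact: nbhs_right_gt.
Unshelve. all: end_near.
Qed.

End Semigroup.

Section Convergence.
Variable R : realType.

Lemma cvg_scale (V : normedModType R[i]) (T : Type) (F : set_system T) {FF : Filter F}
    (a : T -> R) (f : T -> V) (a0 : R) (l : V) :
  a @ F --> a0 -> f @ F --> l -> rC (a t) *: f t @[t --> F] --> rC a0 *: l.
Proof.
move=> ha hf; apply/cvg_nrmP.
have /cvg_distP0 ha' := ha; have /cvg_nrmP hf' := hf.
have : `|a t - a0| * nrm (f t) + `|a0| * nrm (f t - l) @[t --> F] --> (0 : R).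
  have -> : 0 = 0 * nrm l + `|a0| * 0 by rewrite mul0r mulr0 addr0.
  apply: cvgD; last exact: cvgMr.
  by apply: cvgM; [exact: ha' | exact: cvg_nrm].
apply: squeeze0; apply: nearW => t; rewrite nrm_ge0 /= -!nrmZ.
rewrite (le_trans _ (ler_nrmD _ _)) // le_eqVlt; apply/orP; left; apply/eqP; congr nrm.
by rewrite scalerBr /rC rmorphB scalerBl addrA subrK.
Qed.

Lemma cvg_rip (V : completeNormedModType R[i]) (r : V -> V -> R) (T : Type)
    (F : set_system T) {FF : Filter F} (f g : T -> V) (l m : V) :
  is_rip r -> f @ F --> l -> g @ F --> m -> r (f t) (g t) @[t --> F] --> r l m.
Proof.
move=> hr hf hg.
have E x y : r x y = (nrm (x + y) ^+ 2 - nrm (x - y) ^+ 2) / 4.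
  by rewrite (rip_sqrD hr) (rip_sqrB hr); field.
have sq (u : T -> V) x : u @ F --> x -> nrm (u t) ^+ 2 @[t --> F] --> nrm x ^+ 2.
  by move=> ux; rewrite expr2; under eq_fun do rewrite expr2; apply: cvgM; exact: cvg_nrm.
rewrite E; under eq_fun do rewrite E.
by apply: cvgMl; apply: cvgB; apply: sq; [exact: cvgD | exact: cvgB].
Qed.

Lemma expR_diffq_cvg : (expR t - 1) / t @[t --> (0 : R)^'+] --> (1 : R).
Proof.
apply/cvg_distP0.
have h : 2 * t @[t --> (0 : R)^'+] --> (0 : R).
  have : 2 * t @[t --> (0 : R)^'+] --> (2 * 0 : R).
    by apply: cvgM; [exact: cvg_cst | exact: cvg_within].
  by rewrite mulr0.
apply: squeeze0 h; near=> t; rewrite normr_ge0 /=.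
have t0 : 0 < t by near: t; exact: nbhs_right_gt.
have t1 : t < 2^-1 by near: t; apply: nbhs_right_lt; rewrite invr_gt0.
have e1 : 1 + t <= expR t by exact: expR_ge1Dx.
have e2 : 1 - t <= (expR t)^-1 by rewrite -expRN; exact: expR_ge1Dx.
have ep : 0 < expR t by exact: expR_gt0.
have e3 : expR t * (1 - t) <= 1 by rewrite mulrC -ler_pdivlMr // div1r.
have -> : (expR t - 1) / t - 1 = (expR t - 1 - t) / t by field; rewrite gt_eqF.
rewrite ger0_norm ?divr_ge0 ?(ltW t0) //; last by lra.
rewrite ler_pdivrMr //.
(* Then $e^t\le 1/(1-t)\le2$, and $e^t-1-t\le t(e^t-1)\le t^2e^t\le2t^2$. *)
have t1' : t < 1 / 2 by rewrite div1r.
have : expR t <= 2 by nra.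
by nra.
Unshelve. all: end_near.
Qed.

(** Feeds the one-sided limit that defines the generator into a two-sided derivative. *)
Lemma cvg_norm_dnbhs (V : topologicalType) (g : R -> V) (l : V) :
  g t @[t --> 0^'+] --> l -> g `|k| @[k --> (0 : R)^'] --> l.
Proof.
move=> h A /h [d d0 hd]; exists d => // k /= kd k0.
apply: hd; last by rewrite normr_gt0.
by move: kd; rewrite /= !sub0r !normrN normr_id.
Qed.

End Convergence.

Section Rescaling.
Variables (R : realType) (H : completeNormedModType R[i]) (T : R -> H -> H).
Hypothesis hT : C0_semigroup T.
Variable B : R.
Hypotheses (B0 : 0 <= B) (TB : forall t x, 0 <= t -> nrm (T t x) <= B * nrm x).

(** Its generator is $E-1$, so its orbit integrals solve equations for $1-E$, and the factor
    $e^{-t}$ makes a contraction strict at time 1. *)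
Definition rescaled t x : H := rC (expR (- t)) *: T t x.

Lemma rescaled_C0 : C0_semigroup rescaled.
Proof.
have [_ T0 Tadd cT] := hT; split.
- move=> t t0; have linT := semigroup_linear hT t0; apply/bounded_op_nrm; split.
    by move=> a x y; rewrite /rescaled linT scalerDr !scalerA mulrC.
  exists (expR (- t) * B) => [|x]; first by rewrite mulr_ge0 // expR_ge0.
  by rewrite nrmZ ger0_norm ?expR_ge0 // -mulrA ler_wpM2l ?expR_ge0 // TB.
- by move=> x; rewrite /rescaled T0 oppr0 expR0 /rC rmorph1 scale1r.
- move=> s t s0 t0 x; have linT := semigroup_linear hT s0.
  by rewrite /rescaled Tadd // (lopZ linT) scalerA -rCM -expRD opprD.
- move=> x; apply/subspace_continuousP => t t0.
  have /subspace_continuousP/(_ t t0) h := cT x.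
  apply: (cvg_scale _ h).
  apply: (cvg_comp _ expR); last exact: continuous_expR.
  by apply: cvgN; apply: cvg_within.
Qed.

Lemma rescaled_bound t x : 0 <= t -> nrm (rescaled t x) <= B * nrm x.
Proof.
move=> t0; rewrite nrmZ ger0_norm ?expR_ge0 //.
rewrite (le_trans _ (TB x t0)) // ler_piMl ?nrm_ge0 //.
by rewrite -expR0 ler_expR oppr_le0.
Qed.

(** The difference quotient of [T] is $e^t$ times that of [rescaled] plus $\frac{e^t-1}{t}w$. *)
Lemma gen_rescaled w : gen_dom rescaled w -> gen_dom T w /\ gen T w = gen rescaled w + w.
Proof.
move=> /(gen_cvg) hw; apply: genP.
have : rC (expR t) *: diffq rescaled w t + rC ((expR t - 1) / t) *: w @[t --> 0^'+]
    --> rC 1 *: gen rescaled w + rC 1 *: w.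
  apply: cvgD; apply: cvg_scale; [|exact: hw|exact: expR_diffq_cvg|exact: cvg_cst].
  by rewrite -expR0; apply: cvg_at_right_filter; exact: continuous_expR.
rewrite /rC rmorph1 !scale1r -/rC; apply: cvg_trans; apply: near_eq_cvg; near=> t.
have t0 : 0 < t by near: t; exact: nbhs_right_gt.
rewrite /diffq /rescaled !scalerBr !scalerA -!rCM.
rewrite (_ : expR t * t^-1 * expR (- t) = t^-1); last first.
  by rewrite expRN mulrAC mulfV ?mul1r // gt_eqF ?expR_gt0.
rewrite -addrA; congr (_ + _); rewrite -scaleNr -scalerDl -scaleNr; congr (_ *: _).
by rewrite /rC -!rmorphN -rmorphD /=; congr (_%:C)%C; ring.
Unshelve. all: end_near.
Qed.

End Rescaling.

Lemma bochner_measurable_ext (R : realType) (W : normedModType R[i]) (f g : R -> W) :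
  (forall s, 0 <= s -> f s = g s) ->
  bochner_measurable `[0, +oo[ f -> bochner_measurable `[0, +oo[ g.
Proof.
move=> fg [u [su [N [mN N0 hN]]]]; exists u; split => //; exists N; split => // s /= ns.
apply: hN => /= us; apply: ns => s0; rewrite -fg; first exact: us.
by move: s0; rewrite in_itv /= andbT.
Qed.

(** * Bochner measurability of continuous functions *)

Section BochnerContinuous.
Variables (R : realType) (W : normedModType R[i]) (f : R -> W).

(** Dyadic index of [s], capped so that the step function has finitely many values. Its superlevel
    sets are half-lines or empty, hence measurable. *)
Let cell (n : nat) (s : R) : nat := minn (Num.truncn (s * 2 ^+ n)) (4 ^ n).

Let cell_ge n k : `[0, +oo[ `&` [set s | (k <= cell n s)%N] =
  if (k <= 4 ^ n)%N then `[k%:R / 2 ^+ n, +oo[%classic else set0.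
Proof.
have p0 : 0 < (2 : R) ^+ n by rewrite exprn_gt0.
apply/seteqP; split=> s /=; rewrite leq_min in_itv /= andbT.
  move=> [s0 /andP[h ->]] /=; rewrite in_itv /= andbT ler_pdivrMr //.
  have s2 : 0 <= s * 2 ^+ n by rewrite mulr_ge0 // ltW.
  by rewrite -truncn_ge_nat.
case: ifP => // h; rewrite /= in_itv /= andbT => ks.
have s0 : 0 <= s by apply: le_trans ks; rewrite divr_ge0 // ltW.
have s2 : 0 <= s * 2 ^+ n by rewrite mulr_ge0 // ltW.
by split => //; rewrite andbT truncn_ge_nat // -ler_pdivrMr.
Qed.

Let cell_measurable n k : measurable (`[0, +oo[ `&` [set s | cell n s = k]).
Proof.
rewrite (_ : _ `&` _ = (`[0, +oo[ `&` [set s | (k <= cell n s)%N]) `\`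
    (`[0, +oo[ `&` [set s | (k.+1 <= cell n s)%N])); last first.
  apply/seteqP; split=> s /=.
    by move=> [s0 <-]; rewrite leqnn ltnn; split => // -[].
  move=> [[s0 h1] h2]; split => //; apply/eqP; rewrite eqn_leq h1 andbT leqNgt.
  by apply/negP => h; apply: h2.
by rewrite !cell_ge; apply: measurableD; case: ifP.
Qed.

Lemma bochner_measurable_continuous :
  {within `[0, +oo[, continuous f} -> bochner_measurable `[0, +oo[ f.
Proof.
move=> cf; exists (fun n s => f ((cell n s)%:R / 2 ^+ n)); split.
  move=> n; split.
    apply: (@sub_finite_set _ _ ((fun k : nat => f (k%:R / 2 ^+ n)) @` `I_((4 ^ n).+1))).
      by move=> _ [s _ <-]; exists (cell n s) => //=; rewrite ltnS geq_minr.
    exact/finite_image/finite_II.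
  move=> y; rewrite (_ : _ `&` _ = \bigcup_(k in [set k | (k < (4 ^ n).+1)%N /\
      f (k%:R / 2 ^+ n) = y]) (`[0, +oo[ `&` [set s | cell n s = k])); last first.
    apply/seteqP; split=> s /=.
      by move=> [s0 <-]; exists (cell n s) => //=; split => //; rewrite ltnS geq_minr.
    by move=> [k /= [_ <-] [s0 ->]].
  apply: fin_bigcup_measurable => [|k _]; last exact: cell_measurable.
  by apply: (@sub_finite_set _ _ `I_((4 ^ n).+1)); [move=> k [] | exact: finite_II].
apply: aeW => s; rewrite /= in_itv /= andbT => s0.
apply: (cvg_within_nneg cf s0).
  by apply: nearW => n; rewrite divr_ge0 ?exprn_ge0.
have := dyadic_floor_cvg s0; apply: cvg_trans; apply: near_eq_cvg; near=> n.
rewrite /cell; congr (_%:R / _); apply/esym/minn_idPl.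
have p0 : 0 < (2 : R) ^+ n by rewrite exprn_gt0.
rewrite -(ler_nat R); have := @truncn_itv R (s * 2 ^+ n).
rewrite mulr_ge0 ?(ltW p0) // => /(_ isT) /andP[h _]; apply: le_trans h _.
have -> : (4 ^ n)%:R = 2 ^+ n * 2 ^+ n :> R.
  by rewrite -exprMn natrX; congr (_ ^+ _); rewrite -natrM.
rewrite ler_pM2r //.
(* From here on the cap is inactive: $s2^n\le n2^n\le4^n$. *)
have sn : s <= n%:R.
  apply: le_trans (ltW (truncnS_gt s)) _; rewrite ler_nat; near: n.
  by exists (Num.truncn s).+1.
by rewrite (le_trans sn) // -natrX ler_nat ltnW // ltn_expl.
Unshelve. all: end_near.
Qed.

End BochnerContinuous.

(** * From contractions to admissible operators *)

Section Dissipation.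
Variables (R : realType) (H : completeNormedModType R[i]) (r : H -> H -> R).
Hypothesis hr : is_rip r.
Variables (T : R -> H -> H) (S S' : H -> H) (M M' : R).
Hypotheses (hT : C0_semigroup T) (linS : linear_op S) (linS' : linear_op S').
Hypotheses (M0 : 0 <= M) (SM : forall x, nrm (S x) <= M * nrm x).
Hypotheses (M'0 : 0 <= M') (S'M : forall x, nrm (S' x) <= M' * nrm x).
Hypotheses (SK : cancel S S') (S'K : cancel S' S).
Hypothesis contr : forall t, 0 <= t -> forall x, nrm (S (T t (S' x))) <= nrm x.
Local Notation mu := (@lebesgue_measure R).
Let hrT : hform setT r := hr.1.
Let sT := @subspaceT R H.
Local Notation E := (gen T).

Let contrS t x : 0 <= t -> nrm (S (T t x)) <= nrm (S x).
Proof. by move=> t0; rewrite -{1}(SK x) contr. Qed.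

Let nrmS x : nrm x <= M' * nrm (S x).
Proof. by rewrite -{1}(SK x). Qed.

Let B := M' * M.
Let B0 : 0 <= B. Proof. exact: mulr_ge0. Qed.

Let TB t x : 0 <= t -> nrm (T t x) <= B * nrm x.
Proof.
move=> t0; rewrite (le_trans (nrmS _)) // -mulrA ler_wpM2l //.
by rewrite (le_trans (contrS x t0)).
Qed.

Let linT t (t0 : 0 <= t) : linear_op (T t) := semigroup_linear hT t0.

Lemma dissipative h : gen_dom T h -> r (S h) (S (E h)) <= 0.
Proof.
move=> /(gen_cvg) hE.
have c : r (S h) (S (diffq T h t)) @[t --> 0^'+] --> r (S h) (S (E h)).
  by apply: cvg_rip => //; [exact: cvg_cst | exact: (lop_cvg linS SM hE)].
apply: (cvgr_to_le c); near=> t.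
have t0 : 0 < t by near: t; exact: nbhs_right_gt.
have := contrS h (ltW t0).
have -> : T t h = h + rC t *: diffq T h t.
  by rewrite /diffq scalerA -rCM divff ?gt_eqF // /rC rmorph1 scale1r addrC subrK.
rewrite -(@ler_pXn2r _ 2) ?nnegrE ?nrm_ge0 // (lopD linS) (lopZ linS) (rip_sqrD hr).
rewrite (hformZr sT hrT) // => le.
have d0 := sqr_ge0 (nrm (rC t *: S (diffq T h t))).
have : t * r (S h) (S (diffq T h t)) <= 0 by lra.
by rewrite pmulr_rle0.
Unshelve. all: end_near.
Qed.

(** Dissipativity gives $\|Sh\|^2\le\operatorname{Re}\langle Sh,S(h-Eh)\rangle$, and Cauchy-Schwarz
    finishes. *)
Let lower h : gen_dom T h -> nrm (S h) <= nrm (S (h - E h)).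
Proof.
move=> Dh; have d := dissipative Dh; have [h0|h0] := eqVneq (nrm (S h)) 0.
  by rewrite h0 nrm_ge0.
have {}h0 : 0 < nrm (S h) by rewrite lt_def h0 nrm_ge0.
rewrite -(ler_pM2l h0) -expr2 (le_trans _ (le_trans (ler_norm _) (rip_CS _ _ hr))) //.
by rewrite (lopB linS) (hformBr sT hrT) // (ripE hr) lerDl oppr_ge0.
Qed.

Let inj h h' : gen_dom T h -> gen_dom T h' -> h - E h = h' - E h' -> h = h'.
Proof.
move=> Dh Dh' e; apply/eqP; rewrite -subr_eq0; apply/eqP.
have [D e'] := gen_linear hT (-1) Dh' Dh; move: D e'.
rewrite !scaleN1r ![- _ + _]addrC => D e'.
have z : h - h' - E (h - h') = 0.
  by rewrite e' opprD opprK addrACA e addrACA subrr addNr addr0.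
have := lower D; rewrite z (lop0 linS) nrm0 => n0.
by apply/nrm_eq0/eqP; rewrite eq_le nrm_ge0 andbT (le_trans (nrmS _)) // mulr_ge0_le0.
Qed.

(* [w = int_0^1 e^-s T(s) x ds] satisfies [w - E w = x - e^-1 T(1) x], and [1 - e^-1 T(1)] is invertible. *)
Let surj z : exists h, gen_dom T h /\ h - E h = z.
Proof.
have hV := rescaled_C0 hT B0 TB.
have VB := rescaled_bound TB.
(* The Neumann series is applied after conjugation by [S]: there the norm is at most $e^{-1}$, while
   [rescaled T 1] alone is bounded only by a constant that may exceed 1. *)
pose L y := S (rescaled T 1 (S' y)).
have linV := semigroup_linear hV ler01.
have linL : linear_op L by move=> a x y; rewrite /L linS' linV linS.
have Lq y : nrm (L y) <= expR (- 1) * nrm y.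
  rewrite /L /rescaled (lopZ linS) nrmZ ger0_norm ?expR_ge0 // ler_wpM2l ?expR_ge0 //.
  exact: contr.
have q1 : expR (- 1) < 1 :> R by rewrite expR_lt1 ltrN10.
have [G [_ _ GK]] := neumann linL Lq (expR_ge0 _) q1.
pose x := S' (G (S z)).
have xz : x - rescaled T 1 x = z.
  apply: (can_inj SK); rewrite (lopB linS) /x S'K; exact: GK.
have [Dw Ew] := gen_integral hr hV VB x ler01.
have [DTw ETw] := gen_rescaled Dw.
exists (semigroup_integral r (rescaled T) 1 x); split => //.
by rewrite ETw Ew opprD addrC subrK opprB.
Qed.

(** Here $J=(1-E)^{-1}$ and $P=2J-1$ is the Cayley transform. With $x=h-Eh$ one has $Px=h+Eh$, so
    the difference of squares in [b] is $-4\operatorname{Re}\langle Sh,SEh\rangle$. Written this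
    way, [b] has an upper bound that needs no estimate on $P$. *)
Lemma dissipation_op : exists Z : H -> H, bounded_op Z /\
  forall h, gen_dom T h -> nrm (Z (h - E h)) ^+ 2 = - (2 * r (S h) (S (E h))).
Proof.
have [J hJ] := choice surj.
have JD x := (hJ x).1; have JE x := (hJ x).2.
have linJ : linear_op J.
  move=> a x y; have [D e] := gen_linear hT a (JD x) (JD y).
  apply: inj => //; rewrite JE e opprD addrACA -scalerBr !JE //.
have JN x : nrm (S (J x)) <= nrm (S x) by rewrite -{2}(JE x); exact: lower.
pose P x := rC 2 *: J x - x.
have linP : linear_op P.
  move=> a x y; rewrite /P linJ scalerDr opprD addrACA scalerBr !scalerA.
  by rewrite mulrC.
pose b x y := 2^-1 * (r (S x) (S y) - r (S (P x)) (S (P y))).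
have hb : hform setT b.
  have [sD sC sJ sZ] := hform_lop setT linS hr.
  have linSP : linear_op (fun x => S (P x)) by move=> a x y; rewrite linP linS.
  have [pD pC pJ pZ] := hform_lop setT linSP hr.
  split=> *; rewrite /b.
  - by rewrite sD // pD //; ring.
  - by rewrite sC // pC.
  - by rewrite sJ // pJ.
  - by rewrite sZ // pZ //; ring.
have bE x : b x x = - (2 * r (S (J x)) (S (E (J x)))).
  have xE : x = J x - E (J x) by rewrite JE.
  have PE : P x = J x + E (J x).
    rewrite /P {2}xE opprB addrA /rC (rmorphD _ 1 1) rmorph1 scalerDl scale1r.
    by rewrite addrAC addrK.
  rewrite /b PE {1 2}xE (lopB linS) (lopD linS) (hform_sqrB sT hrT) // (hform_sqrD sT hrT) //.
  by field.
(* The summand 1 keeps the upper constant positive even if [M = 0]. *)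
have c0 : 0 < M ^+ 2 + 1 by rewrite ltr_pwDr // sqr_ge0.
have bi x : setT x -> 0 * nrm x ^+ 2 <= b x x <= (M ^+ 2 + 1) * nrm x ^+ 2.
  move=> _; rewrite mul0r; apply/andP; split.
    by rewrite bE oppr_ge0 pmulr_rle0 // dissipative.
  rewrite /b !(ripE hr).
  have h1 : nrm (S x) ^+ 2 <= M ^+ 2 * nrm x ^+ 2.
    by rewrite -exprMn ler_pXn2r ?nnegrE ?mulr_ge0 ?nrm_ge0.
  have h2 := sqr_ge0 (nrm (S (P x))); have h3 := sqr_ge0 (nrm x).
  have h4 := sqr_ge0 (nrm (S x)).
  by rewrite mulrDl mul1r; move: h1 h2 h3 h4; move: (M ^+ 2 * _) => k *; lra.
have dT : dense [set: H] by move=> O [x Ox] _; exists x.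
have [Z [bZ ZE _]] := form_root hr sT dT hb (lexx 0) (ltW c0) c0 bi.
exists Z; split => // h Dh; rewrite ZE // bE.
by have -> : J (h - E h) = h by apply: inj => //; rewrite JE.
Qed.

(** * Differentiating the energy along an orbit *)

Section EnergyIdentity.
Variable Z : H -> H.
Hypothesis bZ : bounded_op Z.
Hypothesis ZE : forall h, gen_dom T h -> nrm (Z (h - E h)) ^+ 2 = - (2 * r (S h) (S (E h))).

(** For [k > 0] the quotient is $T(s)$ applied to the one at 0. For $k=-m<0$ it is $T(s-m)$ applied
    to it, so the operator moves with [k]. *)
Lemma orbit_diffq_cvg s h : 0 < s -> gen_dom T h ->
  rC k^-1 *: (T (k + s) h - T s h) @[k --> (0 : R)^'] --> T s (E h).
Proof.
move=> s0 Dh; apply/cvg_nrmP.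
have c1 : nrm (diffq T h `|k| - E h) @[k --> (0 : R)^'] --> (0 : R).
  by apply: (@cvg_norm_dnbhs _ _ (fun t => nrm (diffq T h t - E h))); apply/cvg_nrmP; exact: gen_cvg.
(* The time of the operator that factors out: [s] for positive [k], [s + k] for negative [k]. *)
pose u (k : R) := s + Num.min k 0.
have c2 : nrm (T (u k) (E h) - T s (E h)) @[k --> (0 : R)^'] --> (0 : R).
  apply/cvg_nrmP; have [_ _ _ /(_ (E h)) cT] := hT.
  apply: (cvg_within_nneg cT (ltW s0)).
    exists s => // k /=; rewrite sub0r normrN => ks _; rewrite /u.
    have := ler_norm (- k); rewrite normrN.
    by rewrite minEle; case: ifP => _; lra.
  apply/cvg_distP0.
  have : `|k| @[k --> (0 : R)^'] --> (0 : R).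
    have : `|k| @[k --> (0 : R)^'] --> `|0 : R| by apply: cvg_norm; exact: cvg_within.
    by rewrite normr0.
  apply: squeeze0; apply: nearW => k; rewrite normr_ge0 /u /= addrAC subrr add0r.
  by case: (leP k 0) => _ //; rewrite normr0.
have : B * nrm (diffq T h `|k| - E h) + nrm (T (u k) (E h) - T s (E h)) @[k --> (0 : R)^']
    --> (B * 0 + 0 : R).
  by apply: cvgD => //; apply: cvgM => //; exact: cvg_cst.
rewrite mulr0 addr0; apply: squeeze0; near=> k; rewrite nrm_ge0 /=.
have k0 : k != 0 by near: k; exact: nbhs_dnbhs_neq.
have ks : `|k| < s.
  near: k; exists s => // k /=; by rewrite sub0r normrN.
have [kp|kn] := ltP 0 k.
  rewrite gtr0_norm // /u min_r ?(ltW kp) // addr0 subrr nrm0 addr0.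
  have linTs := linT (ltW s0).
  rewrite [k + s]addrC (semigroup_add hT _ (ltW s0) (ltW kp)).
  by rewrite -(lopB linTs) -(lopZ linTs) -(lopB linTs) TB // ltW.
have {}kn : k < 0 by rewrite lt_neqAle k0.
pose m := - k; have m0 : 0 < m by rewrite oppr_gt0.
have -> : `|k| = m by rewrite ltr0_norm.
have sm : 0 <= s - m by move: ks; rewrite ltr0_norm // subr_ge0 => /ltW.
have -> : u k = s - m by rewrite /u min_l ?ltW // /m opprK.
have -> : k + s = s - m by rewrite /m opprK addrC.
have linTs := linT sm.
have -> : rC k^-1 *: (T (s - m) h - T s h) = T (s - m) (diffq T h m).
  have -> : T s h = T (s - m) (T m h) by rewrite -(semigroup_add hT _ sm (ltW m0)) subrK.
  rewrite -(lopB linTs) -(lopZ linTs); congr (T _ _).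
  by rewrite /diffq /m invrN /rC rmorphN scaleNr -scalerN opprB.
rewrite -(subrKA (T (s - m) (E h))) (le_trans (ler_nrmD _ _)) // lerD2r.
by rewrite -(lopB linTs) TB.
Unshelve. all: end_near.
Qed.

Let F h s := - nrm (S (T s h)) ^+ 2.
(** Written along the orbit of [h - E h], so that continuity in [s] is that of an orbit; [f_gen]
    recovers the expression with [E (T s h)]. *)
Let f h s := nrm (Z (T s (h - E h))) ^+ 2.

Let f_gen h s : 0 <= s -> gen_dom T h -> f h s = nrm (Z (T s h - E (T s h))) ^+ 2.
Proof.
move=> s0 Dh; rewrite /f (lopB (linT s0)).
by rewrite (gen_invariant hT TB s0 Dh).2.
Qed.

Let F_diffq h s : 0 < s -> gen_dom T h ->
  k^-1 *: (F h (k + s) - F h s) @[k --> (0 : R)^'] --> f h s.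
Proof.
move=> s0 Dh; have hQ := orbit_diffq_cvg s0 Dh.
have [_ _ _ /(_ h) cT] := hT.
have hs : T (k + s) h @[k --> (0 : R)^'] --> T s h.
  apply: (cvg_within_nneg cT (ltW s0)).
    exists s => // k /=; rewrite sub0r normrN => ks _.
    by have := ler_norm (- k); rewrite normrN; lra.
  rewrite -{2}[s]add0r; apply: cvgD; [exact: cvg_within | exact: cvg_cst].
rewrite f_gen ?(ltW s0) // ZE; last exact: (gen_invariant hT TB (ltW s0) Dh).1.
rewrite (gen_invariant hT TB (ltW s0) Dh).2.
(* Difference of squares: $\|a\|^2-\|b\|^2=\operatorname{Re}\langle a-b,a+b\rangle$. *)
have : - r (S (rC k^-1 *: (T (k + s) h - T s h))) (S (T (k + s) h + T s h)) @[k --> (0 : R)^']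
    --> - r (S (T s (E h))) (S (T s h + T s h)).
  apply: cvgN; apply: cvg_rip => //; apply: (lop_cvg linS SM) => //.
  by apply: cvgD => //; exact: cvg_cst.
have -> : - r (S (T s (E h))) (S (T s h + T s h)) = - (2 * r (S (T s h)) (S (T s (E h)))).
  by rewrite (lopD linS) (hformDr sT hrT) // (hformC hrT) //; ring.
apply: cvg_trans; apply: near_eq_cvg; apply: nearW => k.
rewrite (lopZ linS) (hformZl hrT) // (lopB linS) (lopD linS) /F -!(ripE hr).
rewrite (hformBl sT hrT) // !(hformDr sT hrT) // [r (S (T s h)) (S (T (k + s) h))](hformC hrT) //.
by rewrite /GRing.scale /=; ring.
Qed.

Let f_continuous h : {within `[0, +oo[, continuous (f h)}.
Proof.
have /bounded_op_nrm[linZ [N N0 ZN]] := bZ.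
have [_ _ _ /(_ (h - E h))/subspace_continuousP cT] := hT.
apply/subspace_continuousP => s s0.
have c : nrm (Z (T t (h - E h))) @[t --> within `[0, +oo[ (nbhs s)] --> nrm (Z (T s (h - E h))).
  by apply: cvg_nrm; apply: (lop_cvg linZ ZN); exact: cT.
by rewrite /from_subspace /f expr2; under eq_fun do rewrite expr2; exact: cvgM.
Qed.

Let F_cvg (h : H) (s : R) (A : set_system R) {FA : Filter A} : 0 <= s ->
  (\forall t \near A, 0 <= t) -> A --> s -> F h t @[t --> A] --> F h s.
Proof.
move=> s0 A0 As; have [_ _ _ /(_ h) cT] := hT.
have c : nrm (S (T t h)) @[t --> A] --> nrm (S (T s h)).
  by apply: cvg_nrm; apply: (lop_cvg linS SM); exact: (cvg_within_nneg cT s0 A0 As).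
by rewrite /F expr2; apply: cvgN; under eq_fun do rewrite expr2; exact: cvgM.
Qed.

Lemma energy_identity h t : 0 <= t -> gen_dom T h ->
  (\int[mu]_(s in `[0%R, t]%classic) (nrm (Z (T s h - E (T s h))) ^+ 2)%:E =
   (nrm (S h) ^+ 2 - nrm (S (T t h)) ^+ 2)%:E)%E.
Proof.
move=> t0 Dh; have [_ T0 _ _] := hT.
have -> : (\int[mu]_(s in `[0%R, t]%classic) (nrm (Z (T s h - E (T s h))) ^+ 2)%:E =
    \int[mu]_(s in `[0%R, t]%classic) (f h s)%:E)%E.
  apply: eq_integral => s; rewrite inE /= in_itv /= => /andP[s0 _].
  by rewrite f_gen.
(* The fundamental theorem is applied on a nondegenerate interval, so [t = 0] is treated apart. *)
move: t0; rewrite le_eqVlt => /predU1P[<-|t0].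
  by rewrite set_itv1 integral_set1 T0 subrr.
have drv s : s \in `]0, t[%R -> k^-1 *: (F h (k + s) - F h s) @[k --> (0 : R)^'] --> f h s.
  by rewrite in_itv /= => /andP[s0 _]; exact: F_diffq.
rewrite (@continuous_FTC2 _ (f h) (F h)) //.
- by rewrite -EFinB /F T0 opprK addrC.
- apply: continuous_subspaceW (@f_continuous h) => s /=.
  by rewrite !in_itv /= andbT => /andP[].
- split.
  + move=> s /drv c; rewrite /derivable.
    apply/cvg_ex; exists (f h s); move: c; apply: cvg_trans; apply: near_eq_cvg.
    by apply: nearW => k /=; rewrite /GRing.scale /= mulr1.
  + apply: F_cvg => //; last exact: cvg_within.
    by near=> s; apply: ltW; near: s; exact: nbhs_right_gt.
  + apply: F_cvg; [exact: ltW | | exact: cvg_within].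
    by near=> s; apply: ltW; near: s; exact: nbhs_left_gt.
- by move=> s /drv c; rewrite /derive1; apply: cvg_lim.
Unshelve. all: end_near.
Qed.

End EnergyIdentity.
End Dissipation.

Lemma similar_admissible (R : realType) (H : completeNormedModType R[i]) (T : R -> H -> H) :
  hilbert_norm H -> C0_semigroup T -> similar_to_contraction T ->
  exists (K : completeNormedModType R[i]) (C : H -> K),
    [/\ hilbert_norm K, admissible T (gen_dom T) C &
        exists M : R, 0 <= M /\ forall h, gen_dom T h -> nrm (C h) <= M * graph_norm T h].
Proof.
move=> hH hT [S [S' [/bounded_op_nrm[linS [M M0 SM]] /bounded_op_nrm[linS' [M' M'0 S'M]] SK S'K]]].
move=> contr; have [r hr] := hilbert_rip hH.
have contrS t x : 0 <= t -> nrm (S (T t x)) <= nrm (S x).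
  by move=> t0; rewrite -{1}(SK x) contr.
have nrmS x : nrm x <= M' * nrm (S x) by rewrite -{1}(SK x).
have TB t x : 0 <= t -> nrm (T t x) <= M' * M * nrm x.
  move=> t0; rewrite (le_trans (nrmS _)) // -mulrA ler_wpM2l //.
  by rewrite (le_trans (contrS _ _ t0)).
have [Z [bZ ZE]] := dissipation_op hr hT linS linS' M0 SM M'0 S'M SK S'K contr.
have /bounded_op_nrm[linZ [N N0 ZN]] := bZ.
exists H, (fun h => Z (h - gen T h)); split => //; last first.
  exists (N * 2); split; first by rewrite mulr_ge0.
  move=> h _; rewrite (le_trans (ZN _)) // -mulrA ler_wpM2l //.
  rewrite (le_trans (ler_nrmB _ _)) //.
  have g0 (a b : R) : 0 <= a -> 0 <= b -> a <= Num.sqrt (a ^+ 2 + b ^+ 2).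
    by move=> a0 b0; rewrite -{1}(ger0_norm a0) -sqrtr_sqr ler_wsqrtr // lerDl sqr_ge0.
  have h1 := g0 _ _ (nrm_ge0 h) (nrm_ge0 (gen T h)).
  have h2 := g0 _ _ (nrm_ge0 (gen T h)) (nrm_ge0 h).
  by rewrite /graph_norm mulrC mulr_natr mulr2n lerD // addrC.
split.
- split; [exact: gen_dom_subspace | exact: (gen_dom_dense hr hT TB) |].
  move=> a x y Dx Dy; rewrite (gen_linear hT a Dx Dy).2 -linZ; congr Z.
  by rewrite scalerBr opprD addrACA.
- by move=> t t0 h Dh; exact: (gen_invariant hT TB t0 Dh).1.
- move=> h Dh; have bc : {within `[0, +oo[, continuous (fun t => Z (T t (h - gen T h)))}.
    have [_ _ _ /(_ (h - gen T h))/subspace_continuousP cT] := hT.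
    by apply/subspace_continuousP => s s0; exact: (lop_cvg linZ ZN (cT s s0)).
  apply: bochner_measurable_ext (bochner_measurable_continuous bc) => s s0.
  rewrite (lopB (semigroup_linear hT s0)).
  by rewrite (gen_invariant hT TB s0 Dh).2.
- pose k := M ^+ 2 + 1; pose k' := M' ^+ 2 + 1.
  have k1 : 1 <= k by rewrite lerDr sqr_ge0.
  have k1' : 1 <= k' by rewrite lerDr sqr_ge0.
  have k0 : 0 < k by exact: lt_le_trans k1.
  have k0' : 0 < k' by exact: lt_le_trans k1'.
  have Sk x : nrm (S x) ^+ 2 <= k * nrm x ^+ 2.
    rewrite mulrDl mul1r -exprMn ler_wpDr ?sqr_ge0 //.
    by rewrite ler_pXn2r ?nnegrE ?mulr_ge0 ?nrm_ge0.
  have S'k x : nrm x ^+ 2 <= k' * nrm (S x) ^+ 2.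
    rewrite mulrDl mul1r -exprMn ler_wpDr ?sqr_ge0 //.
    by rewrite ler_pXn2r ?nnegrE ?mulr_ge0 ?nrm_ge0.
  (* With $u=\|Sh\|^2$, $v=\|ST(t)h\|^2$, $w=\|T(t)h\|^2$: below, $\|h\|^2\le k'u\le k'k(u-v+w)$,
     using $k\ge1$ and $v\le kw$; above, $w+u-v\le k'v+u\le(k'+1)u\le(k'+1)k\|h\|^2$. *)
  exists ((k * k')^-1), ((k' + 1) * k); split; first by rewrite invr_gt0 mulr_gt0.
    by rewrite mulr_gt0 // addr_gt0.
  move=> h t Dh t0.
  rewrite (energy_identity hr hT linS SM M'0 S'M SK contr bZ ZE t0 Dh).
  rewrite -EFinD !lee_fin.
  have a1 := Sk h; have a2 := S'k h; have a3 := Sk (T t h); have a4 := S'k (T t h).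
  have a5 : nrm (S (T t h)) ^+ 2 <= nrm (S h) ^+ 2.
    by rewrite ler_pXn2r ?nnegrE ?nrm_ge0 ?contrS.
  have a6 := sqr_ge0 (nrm (T t h)); have a7 := sqr_ge0 (nrm (S (T t h))).
  move: a1 a2 a3 a4 a5 a6 a7.
  move: (nrm (S h) ^+ 2) (nrm (S (T t h)) ^+ 2) (nrm (T t h) ^+ 2) (nrm h ^+ 2) => u v w z.
  move=> a1 a2 a3 a4 a5 a6 a7; apply/andP; split.
    rewrite ler_pdivrMl ?mulr_gt0 // (le_trans a2) // [k * k']mulrC -mulrA ler_wpM2l ?(ltW k0') //.
    have : 0 <= (k - 1) * (u - v) by rewrite mulr_ge0 ?subr_ge0.
    by lra.
  have : k' * v <= k' * u by rewrite ler_pM2l.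
  have : (k' + 1) * u <= (k' + 1) * (k * z) by rewrite ler_pM2l // addr_gt0.
  by rewrite mulrDl mul1r mulrA; lra.
Qed.

Lemma admissible_similar_ex (R : realType) (H : completeNormedModType R[i]) (T : R -> H -> H)
    (K : completeNormedModType R[i]) (D : set H) (C : H -> K) :
  hilbert_norm H -> C0_semigroup T -> hilbert_norm K -> admissible T D C ->
  similar_to_contraction T.
Proof.
move=> hH hT hK [[sD dD linC] TD mC [al [be [al0 be0 energy]]]].
have [r hr] := hilbert_rip hH; have [rK hrK] := hilbert_rip hK.
(* If [H] is zero the energy bounds do not force [al <= be]; the maximum restores it. *)
apply: (@admissible_similar _ _ _ _ _ _ r rK hr hrK hT sD dD linC TD mC al (Num.max al be)) => //.
  by rewrite le_max lexx.
move=> h t Dh t0; have /andP[-> le] := energy h t Dh t0; apply: le_trans le _.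
by rewrite lee_fin ler_wpM2r ?sqr_ge0 // le_max lexx orbT.
Qed.

Theorem theorem8p1 (R : realType) (H : completeNormedModType R[i])
    (hH : hilbert_norm H) (T : R -> H -> H) (hT : C0_semigroup T) :
  (similar_to_contraction T <->
     exists (K : completeNormedModType R[i]) (D : set H) (C : H -> K),
       hilbert_norm K /\ admissible T D C)
  /\
  ((exists (K : completeNormedModType R[i]) (D : set H) (C : H -> K),
       hilbert_norm K /\ admissible T D C) ->
   exists (K : completeNormedModType R[i]) (C : H -> K),
     [/\ hilbert_norm K, admissible T (gen_dom T) C &
         exists M : R, 0 <= M /\
           forall h, gen_dom T h -> nrm (C h) <= M * graph_norm T h]).
Proof.
have sim : (exists (K : completeNormedModType R[i]) (D : set H) (C : H -> K),
    hilbert_norm K /\ admissible T D C) -> similar_to_contraction T.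
  by move=> [K [D [C [hK aC]]]]; exact: admissible_similar_ex hH hT hK aC.
split; last by move=> /sim; exact: similar_admissible.
split=> // /(similar_admissible hH hT)[K [C [hK aC _]]].
by exists K, (gen_dom T), C.
Qed.
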